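(* Let $A$ be a finite dimensional weak $C^*$-Hopf algebra, $M$ an $A$-module algebra, $l\in\mathcal L(A)$ a positive left integral, $E_l:M\to N:=M^A$, $E_l(m)=l\triangleright m$, and $e_l:=d_R(l)^{1/2}\,h\,d_R(l)^{1/2}\in A$, where $h$ is the normalized Haar integral. For $m\in M$ consider $m\equiv(m\rtimes1)$ and $e_l\equiv(1_M\rtimes e_l)$ as elements of $M\rtimes A$. Then: (i) $e_l$ is positive, commutes with $M^A$ and satisfies $e_lme_l=E_l(m)e_l=e_lE_l(m)$ for all $m\in M$. (ii) If $l'\in\mathcal L(A)$ is also positive and $e_l=e_{l'}$ (in $A$), then $l=l'$. (iii) $e_l^2=n_\sigma(l)e_l$ for $\sigma=L,R$. In particular, if $l$ is normalized then $e_l$ is a projection. (iv) $l$ is nondegenerate if and only if $e_l$ is nondegenerate (as functionals on $\hat A$). In this case $l$ is normalized if and only if $e_l$ is a projection.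
   Context: A finite dimensional weak $C^*$-Hopf algebra is a finite dimensional $C^*$-algebra $A$ (unit $1$) with linear maps $\Delta:A\to A\otimes A$, $\varepsilon:A\to\mathbb C$, $S:A\to A$ such that, for all $x,y,z\in A$ in Sweedler notation: $\Delta(xy)=\Delta(x)\Delta(y)$; $\Delta(x^* )=\Delta(x)^*$; $(\Delta\otimes\mathrm{id})\Delta=(\mathrm{id}\otimes\Delta)\Delta$; $(\Delta(1)\otimes1)(1\otimes\Delta(1))=1_{(1)}\otimes1_{(2)}\otimes1_{(3)}$; $(\varepsilon\otimes\mathrm{id})\Delta=\mathrm{id}=(\mathrm{id}\otimes\varepsilon)\Delta$; $\varepsilon(xyz)=\varepsilon(xy_{(1)})\varepsilon(y_{(2)}z)$; $S(x_{(1)})x_{(2)}=1_{(1)}\varepsilon(x1_{(2)})$; $x_{(1)}S(x_{(2)})=\varepsilon(1_{(1)}x)1_{(2)}$; $S(x_{(1)})x_{(2)}S(x_{(3)})=S(x)$. ($\Delta(1)\neq 1\otimes 1$ in general; $S$ is automatically invertible.) Put $x_*:=S(x)^*$. The dual $\hat A$ is the dual vector space with $\langle\psi\varphi|x\rangle=\langle\psi\otimes\varphi|\Delta(x)\rangle$, $\hat1=\varepsilon$, $\langle\psi^*|x\rangle=\overline{\langle\psi|x_*\rangle}$ (it is itself a finite dimensional weak $C^*$-Hopf algebra). Write $\langle a\rightharpoonup\varphi|b\rangle=\langle\varphi|ba\rangle$. $A_L=\{(\varphi\otimes\mathrm{id})(\Delta(1)):\varphi\in\hat A\}$, $A_R=\{(\mathrm{id}\otimes\varphi)(\Delta(1)):\varphi\in\hat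 A\}$. Integrals: $l\in A$ is a left integral ($l\in\mathcal L(A)$) if $al=a_{(1)}S(a_{(2)})l$ for all $a\in A$; a right integral if $la=lS(a_{(1)})a_{(2)}$ for all $a$. The normalized Haar integral $h$ is the unique two-sided integral with $S(h_{(1)})h_{(2)}=h_{(1)}S(h_{(2)})=1$. A left integral $l$ is positive if $\langle l|\varphi^*\varphi\rangle\ge0$ for all $\varphi\in\hat A$; normalized if $l\rightharpoonup\hat1=\hat1$; an element $x\in A$ is nondegenerate as a functional on $\hat A$ if the bilinear form $(\varphi,\psi)\mapsto\langle x|\varphi\psi\rangle$ is nondegenerate. For $l\in\mathcal L(A)$: $n_L(l)=l_{(1)}S(l_{(2)})$, $n_R(l)=l_{(2)}S^{-1}(l_{(1)})$, $d_R(l)=S(l_{(1)})l_{(2)}\in A_R$ (with $d_R(l)\ge0$ if $l$ is positive). An $A$-module algebra is a unital $*$-algebra $M$ with a linear left action $\triangleright$ of $A$ with $(ab)\triangleright m=a\triangleright(b\triangleright m)$, $1\triangleright m=m$, $a\triangleright(mn)=(a_{(1)}\triangleright m)(a_{(2)}\triangleright n)$, $(a\triangleright m)^*=a_*\triangleright m^*$, $a\triangleright1_M=(a_{(1)}S(a_{(2)}))\triangleright1_M$. $M^A=\{n: a\triangleright n=a_{(1)}S(a_{(2)})\triangleright n\ \forall a\}$. The crossed product $M\rtimes A=M\otimes_{A_L}A$ (elements $(m\rtimes a)$ modulo $(m\rtimes ba)=(m(b\triangleright1_M)\rtimes a)$, $b\in A_L$) has product $(m\rtimes a)(m'\rtimes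 a')=(m(a_{(1)}\triangleright m')\rtimes a_{(2)}a')$ and $(m\rtimes a)^*=(1_M\rtimes a^* )(m^*\rtimes1)$. In (i) ''positive'' refers to the $C^*$-algebra $A$. *)

(* Defs.v *)
From HB Require Import structures.
From mathcomp Require Import all_boot all_order all_algebra all_field.
From mathcomp Require Import boolp classical_sets reals complex.

Set Implicit Arguments.
Unset Strict Implicit.
Unset Printing Implicit Defensive.
Import Order.TTheory GRing.Theory Num.Theory.
Local Open Scope ring_scope.

(* The tensor product of a (possibly infinite-dimensional) module U with a
   finite-dimensional V: a tensor is given by its U-valued coordinates along the
   basis [vbasis {:V}], i.e. t stands for \sum_i t i (x) (vbasis {:V})`_i. The
   lemmas [tlift_ox] and [tensE] below give the universal property. *)
Notation "U \OX V" := {ffun 'I_(\dim {:V}) -> U}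
  (at level 40, left associativity) : type_scope.

Definition ox (K : fieldType) (U : lmodType K) (V : vectType K) (u : U) (v : V) :
  U \OX V := [ffun i => coord (vbasis {:V}) i v *: u].

(* The additive map induced on U (x) V by a K-balanced biadditive f; it is also
   used for conjugate-bilinear f. [\Sw_(x, y <- t) E] is Sweedler notation. *)
Definition tlift (K : fieldType) (U : lmodType K) (V : vectType K)
    (W : nmodType) (f : U -> V -> W) (t : U \OX V) : W :=
  \sum_i f (t i) (vbasis {:V})`_i.

Notation "u \ox v" := (ox u v) (at level 40, left associativity) : ring_scope.
Notation "'\Sw_' ( x , y <- t ) E" := (tlift (fun x y => E) t)
  (at level 41, x name, y name, t at level 60, E at level 41,
   format "'\Sw_' ( x ,  y  <-  t )  E") : ring_scope.

HB.mixin Record isStarAlgebra (R : realType) B & GRing.Algebra R[i] B := {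
  star : B -> B;
  starK : involutive star;
  starD : {morph star : x y / x + y};
  starZ : forall (c : R[i]) x, star (c *: x) = c^* *: star x;
  starM : forall x y, star (x * y) = star y * star x
}.
#[short(type="starAlgType")]
HB.structure Definition StarAlgebra (R : realType) :=
  { B of isStarAlgebra R B & GRing.Algebra R[i] B }.

(* Nonnegativity of the norm follows from [cnormD] and [cnormZ], and completeness
   is automatic in finite dimension. *)
HB.mixin Record isFinDimCStarAlgebra (R : realType) A
    & Falgebra R[i] A & StarAlgebra R A := {
  cnorm : A -> R;
  cnorm0_eq0 : forall x, cnorm x = 0 -> x = 0;
  cnormD : forall x y, cnorm (x + y) <= cnorm x + cnorm y;
  cnormZ : forall (c : R[i]) x, (cnorm (c *: x))%:C%C = `|c| * (cnorm x)%:C%C;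
  cnormM : forall x y, cnorm (x * y) <= cnorm x * cnorm y;
  cnorm_star : forall x, cnorm (star x * x) = cnorm x ^+ 2
}.
#[short(type="cstarAlgType")]
HB.structure Definition FinDimCStarAlgebra (R : realType) :=
  { A of isFinDimCStarAlgebra R A & Falgebra R[i] A & StarAlgebra R A }.

HB.mixin Record isWeakHopf (R : realType) A & FinDimCStarAlgebra R A := {
  comul : 'Hom(A, A \OX A);
  counit : 'Hom(A, R[i]^o);
  antipode : 'End(A);
  comulM : forall x y : A, comul (x * y) =
    \Sw_(x1, x2 <- comul x) \Sw_(y1, y2 <- comul y) (x1 * y1) \ox (x2 * y2);
  comul_star : forall x : A,
    comul (star x) = \Sw_(x1, x2 <- comul x) star x1 \ox star x2;
  comulA : forall x : A,
    \Sw_(x1, y <- comul x) \Sw_(x2, x3 <- comul y) (x1 \ox x2) \ox x3 =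
    \Sw_(y, x3 <- comul x) comul y \ox x3;
  comul1 :
    \Sw_(a1, a2 <- comul 1) \Sw_(b1, b2 <- comul 1) (a1 \ox (a2 * b1)) \ox b2 =
    \Sw_(y, x3 <- comul 1) comul y \ox x3;
  counitl : forall x : A, \Sw_(x1, x2 <- comul x) counit x1 *: x2 = x;
  counitr : forall x : A, \Sw_(x1, x2 <- comul x) counit x2 *: x1 = x;
  counitM : forall x y z : A, counit (x * y * z) =
    \Sw_(y1, y2 <- comul y) (counit (x * y1) * counit (y2 * z));
  antipodel : forall x : A,
    \Sw_(x1, x2 <- comul x) (antipode x1 * x2) =
    \Sw_(u1, u2 <- comul 1) counit (x * u2) *: u1;
  antipoder : forall x : A,
    \Sw_(x1, x2 <- comul x) (x1 * antipode x2) =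
    \Sw_(u1, u2 <- comul 1) counit (u1 * x) *: u2;
  antipode_mid : forall x : A,
    \Sw_(x1, y <- comul x) \Sw_(x2, x3 <- comul y)
      (antipode x1 * x2 * antipode x3) = antipode x
}.
#[short(type="weakHopfType")]
HB.structure Definition WeakHopf (R : realType) :=
  { A of isWeakHopf R A & FinDimCStarAlgebra R A }.

(* x_* = S(x)^* *)
Definition lstar (R : realType) (A : weakHopfType R) (x : A) : A :=
  star (antipode x).

(* epsL a = a_(1) S(a_(2)),  epsR a = S(a_(1)) a_(2) *)
Definition epsL (R : realType) (A : weakHopfType R) (a : A) : A :=
  \Sw_(a1, a2 <- comul a) (a1 * antipode a2).

Definition epsR (R : realType) (A : weakHopfType R) (a : A) : A :=
  \Sw_(a1, a2 <- comul a) (antipode a1 * a2).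

HB.mixin Record isModuleAlgebra (R : realType) (A : weakHopfType R) M
    & StarAlgebra R M := {
  act : A -> M -> M;
  act_linearl : forall m, linear (act^~ m);
  act_linearr : forall a, linear (act a);
  actM : forall a b m, act (a * b) m = act a (act b m);
  act1 : forall m, act 1 m = m;
  act_mul : forall a m n,
    act a (m * n) = \Sw_(a1, a2 <- comul a) (act a1 m * act a2 n);
  act_star : forall a m, star (act a m) = act (lstar a) (star m);
  act_one : forall a, act a 1 = act (epsL a) 1
}.
#[short(type="moduleAlgType")]
HB.structure Definition ModuleAlgebra (R : realType) (A : weakHopfType R) :=
  { M of isModuleAlgebra R A M & StarAlgebra R M }.

Section LinearFacts.
Variables (K : nzRingType) (U W : lmodType K) (f : U -> W).
Hypothesis lf : linear f.
Lemma lin0 : f 0 = 0.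
Proof. by have := lf (-1) 0 0; rewrite scaler0 addr0 scaleN1r addNr. Qed.
Lemma linD x y : f (x + y) = f x + f y.
Proof. by have := lf 1 x y; rewrite !scale1r. Qed.
Lemma linZ c x : f (c *: x) = c *: f x.
Proof. by have := lf c x 0; rewrite !addr0 lin0 addr0. Qed.
Lemma lin_sum I (r : seq I) (F : I -> U) :
  f (\sum_(i <- r) F i) = \sum_(i <- r) f (F i).
Proof.
elim: r => [|i r IH]; first by rewrite !big_nil lin0.
by rewrite !big_cons linD IH.
Qed.
End LinearFacts.

Section TensorFacts.
Variables (K : fieldType) (U : lmodType K) (V : vectType K).

Lemma ox_linl (v : V) : linear (fun u : U => u \ox v).
Proof.
move=> c x y; apply/ffunP=> i; rewrite !ffunE /=.
by rewrite scalerDr !scalerA mulrC.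
Qed.

Lemma ox_linr (u : U) : linear (fun v : V => u \ox v).
Proof.
move=> c x y; apply/ffunP=> i; rewrite !ffunE /=.
by rewrite linearP scalerDl scalerA.
Qed.

Lemma eq_tlift (W : nmodType) (f g : U -> V -> W) (t : U \OX V) :
  f =2 g -> tlift f t = tlift g t.
Proof. by move=> fg; apply: eq_bigr => i _; apply: fg. Qed.

Lemma tlift_linear (W : lmodType K) (f : U -> V -> W) :
  (forall v, linear (f^~ v)) -> linear (tlift f).
Proof.
move=> lf c s t; rewrite /tlift scaler_sumr -big_split /=.
by apply: eq_bigr => i _; rewrite !ffunE /=; apply: lf.
Qed.

Lemma tlift_param (X W : lmodType K) (f : X -> U -> V -> W) (t : U \OX V) :
  (forall u v, linear (fun x => f x u v)) -> linear (fun x => tlift (f x) t).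
Proof.
move=> lf c x y; rewrite /tlift scaler_sumr -big_split /=.
by apply: eq_bigr => i _; apply: lf.
Qed.

Lemma lin_tlift (X W : lmodType K) (g : X -> W) (f : U -> V -> X) (t : U \OX V) :
  linear g -> g (tlift f t) = \Sw_(u, v <- t) g (f u v).
Proof. by move=> lg; rewrite /tlift (lin_sum lg). Qed.

(* The universal property of the tensor product. *)
Lemma tlift_ox (W : lmodType K) (f : U -> V -> W) (u : U) (v : V) :
  (forall v, linear (f^~ v)) -> (forall u, linear (f u)) ->
  tlift f (u \ox v) = f u v.
Proof.
move=> l1 l2; rewrite [in RHS](coord_vbasis (memvf v)) (lin_sum (l2 u)).
by apply: eq_bigr => i _; rewrite ffunE /= (linZ (l1 _)) (linZ (l2 _)).
Qed.

Lemma tensE (t : U \OX V) : t = \Sw_(u, v <- t) u \ox v.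
Proof.
apply/ffunP=> j; rewrite /tlift sum_ffunE (bigD1 j) //= ffunE.
rewrite coord_free ?(basis_free (vbasisP _)) // eqxx scale1r big1 ?addr0 // => i ij.
by rewrite ffunE coord_free ?(basis_free (vbasisP _)) // (negPf ij) scale0r.
Qed.

End TensorFacts.

Lemma linfun_lin (K : fieldType) (X Y : vectType K) (f : X -> Y) :
  linear f -> linfun f =1 f.
Proof.
move=> lf x.
pose lm := GRing.isLinear.Build K X Y *:%R f lf.
pose g : {linear X -> Y} := HB.pack f lm.
exact: (lfunE g).
Qed.

Section LinearClosure.
Variable K : fieldType.

Lemma lfun_lin (X Y : vectType K) (f : 'Hom(X, Y)) : linear f.
Proof. by move=> c x y; rewrite linearP. Qed.

Lemma comp_lin (X Y Z : lmodType K) (g : Y -> Z) (f : X -> Y) :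
  linear g -> linear f -> linear (fun x => g (f x)).
Proof. by move=> lg lf c x y; rewrite lf lg. Qed.

Lemma id_lin (X : lmodType K) : linear (fun x : X => x). Proof. by []. Qed.

Lemma mull_lin (B : algType K) (X : lmodType K) (b : B) (f : X -> B) :
  linear f -> linear (fun x => b * f x).
Proof. by move=> lf c x y; rewrite lf mulrDr scalerAr. Qed.

Lemma mulr_lin (B : algType K) (X : lmodType K) (b : B) (f : X -> B) :
  linear f -> linear (fun x => f x * b).
Proof. by move=> lf c x y; rewrite lf mulrDl scalerAl. Qed.

Lemma scalel_lin (X Y : lmodType K) (y : Y) (f : X -> K^o) :
  linear f -> linear (fun x => (f x : K) *: y).
Proof. by move=> lf c x z; rewrite lf scalerDl scalerA. Qed.

Lemma oxl_lin (X U : lmodType K) (V : vectType K) (v : V) (f : X -> U) :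
  linear f -> linear (fun x => f x \ox v).
Proof. exact: comp_lin (ox_linl v). Qed.

Lemma oxr_lin (X U : lmodType K) (V : vectType K) (u : U) (f : X -> V) :
  linear f -> linear (fun x => u \ox f x).
Proof. exact: comp_lin (ox_linr u). Qed.

Lemma tliftt_lin (X U W : lmodType K) (V : vectType K) (f : U -> V -> W)
   (t : X -> U \OX V) :
  linear t -> (forall v, linear (f^~ v)) -> linear (fun x => tlift f (t x)).
Proof. by move=> lt lf; apply: (comp_lin (tlift_linear lf)). Qed.

Lemma lfun_comp_lin (U : lmodType K) (X Y : vectType K) (f : 'Hom(X, Y)) (g : U -> X) :
  linear g -> linear (fun x => f (g x)).
Proof. exact: comp_lin (lfun_lin f). Qed.

End LinearClosure.

Section ActionLinear.
Variables (R : realType) (A : weakHopfType R).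
Local Notation K := R[i].

Lemma actl_lin (M : moduleAlgType A) (X : lmodType K) (m : M) (f : X -> A) :
  linear f -> linear (fun x => act (f x) m).
Proof. exact: comp_lin (act_linearl m). Qed.

Lemma actr_lin (M : moduleAlgType A) (X : lmodType K) (a : A) (f : X -> M) :
  linear f -> linear (fun x => act a (f x)).
Proof. exact: comp_lin (act_linearr a). Qed.
End ActionLinear.

Ltac lin1 := lazymatch goal with
  | |- forall _, _ => move=> ? /=
  | |- GRing.linear_for _ (fun x => x) => exact: id_lin
  | |- GRing.linear_for _ (fun x => act _ _) =>
      first [apply: actl_lin | apply: actr_lin]
  | |- GRing.linear_for _ (fun x => _ * _) =>
      first [apply: mull_lin | apply: mulr_lin]
  | |- GRing.linear_for _ (fun x => _ *: _) => apply: scalel_lin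
  | |- GRing.linear_for _ (fun x => _ \ox _) =>
      first [apply: oxl_lin | apply: oxr_lin]
  | |- GRing.linear_for _ (fun x => tlift _ _) =>
      first [apply: tlift_param | apply: tliftt_lin]
  | |- GRing.linear_for _ (fun x => tlift _ x) => apply: tlift_linear
  | |- GRing.linear_for _ (fun x => fun_of_lfun _ _) => apply: lfun_comp_lin
  | |- GRing.linear_for _ (act _) => exact: act_linearr
  | |- GRing.linear_for _ ( *%R ?b) => exact: (mull_lin b (@id_lin _ _))
  | |- GRing.linear_for _ (ox _) => exact: ox_linr
  | |- GRing.linear_for _ (fun_of_lfun _) => exact: lfun_lin
  end.
Ltac lin := repeat lin1.

Section WeakHopfTheory.
Variables (R : realType) (A : weakHopfType R).
Local Notation K := R[i].

(* The subalgebra A_L, spanned by the second legs of Delta(1). *)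
Definition in_AL (b : A) : Prop :=
  exists phi : 'Hom(A, K^o),
    b = \Sw_(u1, u2 <- comul 1) (phi u1 : K) *: u2.

Lemma comul_assoc (W : lmodType K) (F : A -> A -> A -> W) x :
    (forall b c, linear (fun a => F a b c)) ->
    (forall a c, linear (fun b => F a b c)) ->
    (forall a b, linear (F a b)) ->
  \Sw_(x1, y <- comul x) \Sw_(x2, x3 <- comul y) F x1 x2 x3 =
  \Sw_(y, x3 <- comul x) \Sw_(x1, x2 <- comul y) F x1 x2 x3.
Proof.
move=> l1 l2 l3.
pose G := tlift (fun (s : A \OX A) x3 => \Sw_(x1, x2 <- s) F x1 x2 x3).
have lG : linear G.
  apply: tlift_linear => v; apply: tlift_linear => w; exact: l1.
have /(congr1 G) := comulA x.
rewrite (lin_tlift _ _ lG).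
under eq_tlift => a b do rewrite (lin_tlift _ _ lG).
rewrite (lin_tlift _ _ lG).
have GE s c : G (s \ox c) = \Sw_(x1, x2 <- s) F x1 x2 c.
  rewrite /G tlift_ox //; last by move=> u; apply: tlift_param.
  by move=> v; apply: tlift_linear.
move=> H; transitivity (\Sw_(x1, y <- comul x) \Sw_(x2, x3 <- comul y) G (x1 \ox x2 \ox x3)).
  do 2!apply: eq_tlift => ? ?; rewrite GE tlift_ox //.
by rewrite H; apply: eq_tlift => ? ?; rewrite GE.
Qed.

Lemma comul_mul (W : lmodType K) (F : A -> A -> W) x y :
    (forall b, linear (F^~ b)) -> (forall a, linear (F a)) ->
  \Sw_(z1, z2 <- comul (x * y)) F z1 z2 =
  \Sw_(x1, x2 <- comul x) \Sw_(y1, y2 <- comul y) F (x1 * y1) (x2 * y2).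
Proof.
move=> l1 l2; have lG := tlift_linear l1.
rewrite comulM (lin_tlift _ _ lG); apply: eq_tlift => x1 x2.
by rewrite (lin_tlift _ _ lG); apply: eq_tlift => y1 y2; rewrite tlift_ox.
Qed.

Lemma tlift_exch (U U' : lmodType K) (V V' : vectType K) (W : nmodType)
    (F : U -> V -> U' -> V' -> W) (s : U \OX V) (t : U' \OX V') :
  \Sw_(a, b <- s) \Sw_(c, d <- t) F a b c d =
  \Sw_(c, d <- t) \Sw_(a, b <- s) F a b c d.
Proof. exact: exchange_big. Qed.

Lemma comul1_mid (W : lmodType K) (F : A -> A -> A -> W) :
    (forall b c, linear (fun a => F a b c)) ->
    (forall a c, linear (fun b => F a b c)) ->
    (forall a b, linear (F a b)) ->
  \Sw_(a1, a2 <- comul 1) \Sw_(b1, b2 <- comul 1) F a1 (a2 * b1) b2 =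
  \Sw_(x1, y <- comul 1) \Sw_(x2, x3 <- comul y) F x1 x2 x3.
Proof.
move=> l1 l2 l3; rewrite comul_assoc //.
pose G := tlift (fun (s : A \OX A) x3 => \Sw_(x1, x2 <- s) F x1 x2 x3).
have lG : linear G.
  apply: tlift_linear => v; apply: tlift_linear => w; exact: l1.
have GE s c : G (s \ox c) = \Sw_(x1, x2 <- s) F x1 x2 c.
  rewrite /G tlift_ox //; last by move=> u; apply: tlift_param.
  by move=> v; apply: tlift_linear.
have /(congr1 G) := comul1 (s := A).
rewrite (lin_tlift _ _ lG).
under eq_tlift => a b do rewrite (lin_tlift _ _ lG).
rewrite (lin_tlift _ _ lG) => H.
transitivity (\Sw_(a1, a2 <- comul (1 : A)) \Sw_(b1, b2 <- comul (1 : A))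
   G (a1 \ox (a2 * b1) \ox b2)).
  do 2!apply: eq_tlift => ? ?; rewrite GE tlift_ox //.
by rewrite H; apply: eq_tlift => ? ?; rewrite GE.
Qed.

Section Antilinear.
Variables (U W X : lmodType K) (V : vectType K).

Definition antilin (X Y : lmodType K) (g : X -> Y) :=
  forall (c : K) x y, g (c *: x + y) = c^* *: g x + g y.

Lemma anti_lin0 (g : X -> W) : antilin g -> g 0 = 0.
Proof.
by move=> lf; have := lf (-1) 0 0; rewrite scaler0 addr0 rmorphN1 scaleN1r addNr.
Qed.

Lemma anti_sum (g : X -> W) I (r : seq I) (F : I -> X) : antilin g ->
  g (\sum_(i <- r) F i) = \sum_(i <- r) g (F i).
Proof.
move=> lf; elim: r => [|i r IH]; first by rewrite !big_nil anti_lin0.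
by rewrite !big_cons -[F i]scale1r lf IH rmorph1 !scale1r.
Qed.

Lemma antiZ (g : X -> W) c x : antilin g -> g (c *: x) = c^* *: g x.
Proof. by move=> lf; have := lf c x 0; rewrite !addr0 anti_lin0 // addr0. Qed.
End Antilinear.

Lemma tlift_anti (U W : lmodType K) (V : vectType K) (f : U -> V -> W) :
  (forall v, antilin (f^~ v)) -> antilin (tlift f).
Proof.
move=> lf c s t; rewrite /tlift scaler_sumr -big_split /=.
by apply: eq_bigr => i _; rewrite !ffunE /=; apply: lf.
Qed.

Lemma anti_tlift (U W X : lmodType K) (V : vectType K) (g : X -> W)
    (f : U -> V -> X) (t : U \OX V) :
  antilin g -> g (tlift f t) = \Sw_(u, v <- t) g (f u v).
Proof. by move=> lg; rewrite /tlift (anti_sum _ _ lg). Qed.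

Lemma tlift_ox_anti (U W : lmodType K) (V : vectType K) (f : U -> V -> W) u v :
  (forall v, antilin (f^~ v)) -> (forall u, antilin (f u)) ->
  tlift f (u \ox v) = f u v.
Proof.
move=> l1 l2; rewrite [in RHS](coord_vbasis (memvf v)) (anti_sum _ _ (l2 u)).
by apply: eq_bigr => i _; rewrite ffunE /= (antiZ _ _ (l1 _)) (antiZ _ _ (l2 _)).
Qed.

Lemma star_anti (B : starAlgType R) : antilin (@star R B).
Proof. by move=> c x y; rewrite starD starZ. Qed.

Lemma star1 (B : starAlgType R) : star (1 : B) = 1.
Proof. by rewrite -[LHS]mulr1 -[X in _ * X]starK -starM mulr1 starK. Qed.

Lemma comul1_star (W : lmodType K) (F : A -> A -> W) :
    (forall b, linear (F^~ b)) -> (forall a, linear (F a)) ->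
  \Sw_(u1, u2 <- comul 1) F (star u1) (star u2) = \Sw_(u1, u2 <- comul 1) F u1 u2.
Proof.
move=> l1 l2; rewrite -[in RHS](star1 A) comul_star.
rewrite (lin_tlift _ _ (tlift_linear l1)).
by apply: eq_tlift => ? ?; rewrite tlift_ox.
Qed.

Lemma comul1_midC (W : lmodType K) (F : A -> A -> A -> W) :
    (forall b c, linear (fun a => F a b c)) ->
    (forall a c, linear (fun b => F a b c)) ->
    (forall a b, linear (F a b)) ->
  \Sw_(a1, a2 <- comul 1) \Sw_(b1, b2 <- comul 1) F a1 (b1 * a2) b2 =
  \Sw_(x1, y <- comul 1) \Sw_(x2, x3 <- comul y) F x1 x2 x3.
Proof.
move=> l1 l2 l3; rewrite comul_assoc //.
pose st2 (s : A \OX A) := \Sw_(a, b <- s) star a \ox star b.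
have an2l b : antilin (fun a : A => star a \ox star b).
  by move=> c x y; rewrite star_anti (linD (ox_linl _)) (linZ (ox_linl _)).
have an2r a : antilin (fun b : A => star a \ox star b).
  by move=> c x y; rewrite star_anti (linD (ox_linr _)) (linZ (ox_linr _)).
have an2 : antilin st2 by apply: tlift_anti.
pose st3 (s : (A \OX A) \OX A) := \Sw_(a, b <- s) st2 a \ox star b.
have an3l b : antilin (fun a => st2 a \ox star b).
  by move=> c x y; rewrite an2 (linD (ox_linl _)) (linZ (ox_linl _)).
have an3r a : antilin (fun b : A => st2 a \ox star b).
  by move=> c x y; rewrite star_anti (linD (ox_linr _)) (linZ (ox_linr _)).
have an3 : antilin st3 by apply: tlift_anti.
pose G := tlift (fun (s : A \OX A) x3 => \Sw_(x1, x2 <- s) F x1 x2 x3).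
have lG : linear G.
  apply: tlift_linear => v; apply: tlift_linear => w; exact: l1.
have GE s c : G (s \ox c) = \Sw_(x1, x2 <- s) F x1 x2 c.
  rewrite /G tlift_ox //; last by move=> u; apply: tlift_param.
  by move=> v; apply: tlift_linear.
have /(congr1 st3)/(congr1 G) := comul1 (s := A).
rewrite (anti_tlift _ _ an3) (lin_tlift _ _ lG).
under eq_tlift => a b do rewrite (anti_tlift _ _ an3) (lin_tlift _ _ lG).
rewrite (anti_tlift _ _ an3) (lin_tlift _ _ lG) => H.
transitivity (\Sw_(a1, a2 <- comul (1 : A)) \Sw_(b1, b2 <- comul (1 : A))
   G (st3 (a1 \ox (a2 * b1) \ox b2))).
  rewrite -comul1_star /=; last 2 first.
  - by move=> b; apply: tlift_param => ? ?; apply: l1.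
  - move=> a; apply: tlift_param => u v.
    by apply: (comp_lin (g := fun z => F a z v)) => //; exact: mull_lin (@id_lin _ A).
  apply: eq_tlift => a1 a2; rewrite -comul1_star /=; last 2 first.
  - move=> b; apply: (comp_lin (g := fun z => F (star a1) z b)) => //.
    exact: mulr_lin (@id_lin _ A).
  - by move=> a; apply: l3.
  apply: eq_tlift => b1 b2; rewrite /st3 tlift_ox_anti // /st2 tlift_ox_anti //.
  all: try by [exact: an2l | exact: an2r | exact: an3l | exact: an3r].
  by rewrite GE tlift_ox // starM.
rewrite H [RHS](_ : _ = \Sw_(y, x3 <- comul (1 : A)) G (comul y \ox x3)); last first.
  by apply: eq_tlift => ? ?; rewrite GE.
rewrite -[RHS]comul1_star /=; last 2 first.
- move=> b; apply: (comp_lin lG); apply: oxl_lin; exact: lfun_lin.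
- move=> a; apply: (comp_lin lG); exact: ox_linr.
apply: eq_tlift => a b; rewrite /st3 tlift_ox_anti ?comul_star //.
all: try by [exact: an3l | exact: an3r].
Qed.

Lemma comul_ALl (W : lmodType K) (F : A -> A -> W) b : in_AL b ->
    (forall b, linear (F^~ b)) -> (forall a, linear (F a)) ->
  \Sw_(b1, b2 <- comul b) F b1 b2 = \Sw_(u1, u2 <- comul 1) F (b * u1) u2.
Proof.
move=> [phi ->] l1 l2; pose G (a b c : A) := (phi a : K) *: F b c.
have G1 y z : linear (fun x => G x y z) by apply: scalel_lin; exact: lfun_lin.
have G2 x z : linear (fun y => G x y z).
  by move=> c y y'; rewrite /G l1 scalerDr !scalerA mulrC.
have G3 x y : linear (G x y).
  by move=> c z z'; rewrite /G l2 scalerDr !scalerA mulrC.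
have := comul1_mid G1 G2 G3; rewrite /G => H.
transitivity (\Sw_(x1, y <- comul (1 : A)) \Sw_(x2, x3 <- comul y) (phi x1 : K) *: F x2 x3).
  have lH : linear (fun b => tlift F (comul b)).
    by apply: tliftt_lin => //; exact: lfun_lin.
  rewrite (lin_tlift _ _ lH); apply: eq_tlift => x y; rewrite (linZ lH).
  by rewrite /tlift scaler_sumr.
rewrite -H tlift_exch; apply: eq_tlift => u v.
have lF : linear (fun b => F (b * u) v).
  by apply: (comp_lin (g := fun z => F z v)) => //; exact: mulr_lin (@id_lin _ A).
rewrite (lin_tlift _ _ lF); apply: eq_tlift => x y.
by rewrite (linZ lF).
Qed.

Lemma comul_ALr (W : lmodType K) (F : A -> A -> W) b : in_AL b ->
    (forall b, linear (F^~ b)) -> (forall a, linear (F a)) ->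
  \Sw_(b1, b2 <- comul b) F b1 b2 = \Sw_(u1, u2 <- comul 1) F (u1 * b) u2.
Proof.
move=> [phi ->] l1 l2; pose G (a b c : A) := (phi a : K) *: F b c.
have G1 y z : linear (fun x => G x y z) by apply: scalel_lin; exact: lfun_lin.
have G2 x z : linear (fun y => G x y z).
  by move=> c y y'; rewrite /G l1 scalerDr !scalerA mulrC.
have G3 x y : linear (G x y).
  by move=> c z z'; rewrite /G l2 scalerDr !scalerA mulrC.
have := comul1_midC G1 G2 G3; rewrite /G => H.
transitivity (\Sw_(x1, y <- comul (1 : A)) \Sw_(x2, x3 <- comul y) (phi x1 : K) *: F x2 x3).
  have lH : linear (fun b => tlift F (comul b)).
    by apply: tliftt_lin => //; exact: lfun_lin.
  rewrite (lin_tlift _ _ lH); apply: eq_tlift => x y; rewrite (linZ lH).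
  by rewrite /tlift scaler_sumr.
rewrite -H tlift_exch; apply: eq_tlift => u v.
have lF : linear (fun b => F (u * b) v).
  by apply: (comp_lin (g := fun z => F z v)) => //; exact: mull_lin (@id_lin _ A).
rewrite (lin_tlift _ _ lF); apply: eq_tlift => x y.
by rewrite (linZ lF).
Qed.

Lemma epsL_AL a : in_AL (epsL a).
Proof.
have l : linear (fun u : A => counit (u * a) : K^o).
  by apply: (lfun_comp_lin); exact: mulr_lin (@id_lin _ A).
exists (linfun (fun u : A => counit (u * a) : K^o)); rewrite /epsL antipoder.
by apply: eq_tlift => u v; rewrite (linfun_lin l).
Qed.

Lemma epsL_mul (x : A) : \Sw_(x1, x2 <- comul x) (epsL x1 * x2) = x.
Proof.
rewrite -[RHS](counitl x) -[in RHS](mul1r x) comul_mul; last 2 first.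
- by move=> b; apply: scalel_lin; exact: lfun_lin.
- by move=> a c y z; rewrite scalerDr !scalerA mulrC.
rewrite tlift_exch; apply: eq_tlift => x1 x2.
rewrite /epsL antipoder.
rewrite (lin_tlift _ _ (mulr_lin _ (@id_lin _ A))).
by apply: eq_tlift => u v; rewrite scalerAl.
Qed.

Lemma comul1_AL : exists v : 'I_(\dim {:A}) -> A, (forall j, in_AL (v j)) /\
  forall (W : lmodType K) (F : A -> A -> W),
    (forall b, linear (F^~ b)) -> (forall a, linear (F a)) ->
    \Sw_(u1, u2 <- comul 1) F u1 u2 =
    \sum_(j < \dim {:A}) F (vbasis {:A})`_j (v j).
Proof.
exists (fun j => \Sw_(u1, u2 <- comul 1) (coord (vbasis {:A}) j u1) *: u2); split.
  move=> j; pose g : {linear A -> K^o} := coord (vbasis {:A}) j.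
  by exists (linfun g); apply: eq_tlift => u v; rewrite lfunE.
move=> W F l1 l2.
under [RHS]eq_bigr => j _ do rewrite (lin_tlift _ _ (l2 _)).
rewrite [in RHS]exchange_big /=; apply: eq_bigr => i _.
rewrite {1}(coord_vbasis (memvf (comul (1 : A) i))) (lin_sum (l1 _)).
by apply: eq_bigr => j _; rewrite (linZ (l1 _)) (linZ (l2 _)).
Qed.

End WeakHopfTheory.

Section CrossedProduct.
Variables (R : realType) (A : weakHopfType R) (M : moduleAlgType A).
Local Notation K := R[i].

(* The relations m (b |> 1_M) (x) a ~ m (x) b a, b in A_L, defining the tensor
   product of M and A over A_L as a quotient of M (x) A. *)
Definition balanced_gen (m : M) (b a : A) : M \OX A :=
  (m * act b 1) \ox a - m \ox (b * a).

Definition balanced (t : M \OX A) : Prop :=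
  exists s : seq (M * A * A), (forall p, p \in s -> in_AL p.1.2) /\
    t = \sum_(p <- s) balanced_gen p.1.1 p.1.2 p.2.

Definition balanced_pred : {pred M \OX A} := [pred t | `[< balanced t >]].

Lemma balanced_genZ c m b a :
  c *: balanced_gen m b a = balanced_gen (c *: m) b a.
Proof.
by rewrite /balanced_gen scalerBr -!(linZ (ox_linl _)) scalerAl.
Qed.

Lemma balancedP c s t : balanced s -> balanced t -> balanced (c *: s + t).
Proof.
move=> [ss [Hs ->]] [st [Ht ->]].
exists ([seq (c *: p.1.1, p.1.2, p.2) | p <- ss] ++ st); split.
  move=> p; rewrite mem_cat => /orP[/mapP[q qs ->]|]; last exact: Ht.
  exact: (Hs q qs).
rewrite big_cat big_map /= scaler_sumr; congr (_ + _).
by apply: eq_bigr => p _; rewrite balanced_genZ.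
Qed.

Lemma balanced_gen_in m b a : in_AL b -> balanced (balanced_gen m b a).
Proof.
move=> bL; exists [:: (m, b, a)]; split; last by rewrite big_seq1.
by move=> p; rewrite inE => /eqP ->.
Qed.

Lemma balanced0 : balanced 0.
Proof. by exists [::]; split => //; rewrite big_nil. Qed.

Lemma balanced_zmod : zmod_closed balanced_pred.
Proof.
split=> [|s t]; first by apply/asboolP; exact: balanced0.
move=> /asboolP Hs /asboolP Ht; apply/asboolP.
by rewrite addrC -scaleN1r; apply: balancedP.
Qed.

HB.instance Definition _ := GRing.isZmodClosed.Build (M \OX A) balanced_pred
  balanced_zmod.

Definition crossed := Quotient.quot balanced_pred.

HB.instance Definition _ := GRing.Zmodule.on crossed.

Definition cproj (t : M \OX A) : crossed := \pi_crossed%qT t.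

Definition crepr (x : crossed) : M \OX A := repr x.

Lemma creprK : cancel crepr cproj.
Proof. exact: reprK. Qed.

Lemma cproj_eq (s t : M \OX A) : (cproj s = cproj t) <-> balanced (s - t).
Proof.
split.
  by move/eqP; rewrite -Quotient.idealrBE => /asboolP.
by move=> H; apply/eqP; rewrite -Quotient.idealrBE; apply/asboolP.
Qed.

Lemma cprojD s t : cproj (s + t) = cproj s + cproj t.
Proof. by rewrite /cproj !piE. Qed.

Definition cscale (c : K) (x : crossed) : crossed := cproj (c *: crepr x).

Lemma cscale_proj c t : cscale c (cproj t) = cproj (c *: t).
Proof.
apply/cproj_eq; rewrite -scalerBr -[_ *: _]addr0; apply: balancedP.
  by apply/cproj_eq; rewrite creprK.
exact: balanced0.
Qed.

Lemma cscaleA c d x : cscale c (cscale d x) = cscale (c * d) x.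
Proof. by rewrite -[x]creprK !cscale_proj scalerA. Qed.
Lemma cscale1 : left_id 1 cscale.
Proof. by move=> x; rewrite -[x]creprK !cscale_proj scale1r. Qed.
Lemma cscaleDr : right_distributive cscale +%R.
Proof.
move=> c x y; rewrite -[x]creprK -[y]creprK !cscale_proj -!cprojD.
by rewrite cscale_proj scalerDr.
Qed.
Lemma cscaleDl v : {morph cscale^~ v : a b / a + b}.
Proof.
by move=> a b; rewrite -[v]creprK !cscale_proj -!cprojD scalerDl.
Qed.

HB.instance Definition _ := GRing.Zmodule_isLmodule.Build K crossed
  cscaleA cscale1 cscaleDr cscaleDl.

Lemma cproj_lin : linear cproj.
Proof. by move=> c s t; rewrite cprojD -cscale_proj. Qed.

Definition rtimes (m : M) (a : A) : crossed := cproj (m \ox a).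

Lemma rtimes_linl a : linear (rtimes^~ a).
Proof. exact: comp_lin cproj_lin (ox_linl a). Qed.

Lemma rtimes_linr m : linear (rtimes m).
Proof. exact: comp_lin cproj_lin (ox_linr m). Qed.

Lemma rtimes_balanced m b a : in_AL b -> rtimes (m * act b 1) a = rtimes m (b * a).
Proof. by move=> bL; apply/cproj_eq/balanced_gen_in. Qed.

(* The product of the crossed product, lifted to M (x) A; it descends to
   [crossed] by [cmulE]. *)
Definition cmul_pre (t t' : M \OX A) : M \OX A :=
  \Sw_(m, a <- t) \Sw_(m', a' <- t')
    \Sw_(a1, a2 <- comul a) (m * act a1 m') \ox (a2 * a').

Lemma cmul_preE m a m' a' : cmul_pre (m \ox a) (m' \ox a') =
  \Sw_(a1, a2 <- comul a) (m * act a1 m') \ox (a2 * a').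
Proof. by rewrite /cmul_pre !tlift_ox //; lin. Qed.

Lemma cmul_pre_linl t' : linear (cmul_pre^~ t').
Proof. by rewrite /cmul_pre; lin. Qed.

Lemma cmul_pre_linr t : linear (cmul_pre t).
Proof. by rewrite /cmul_pre; lin. Qed.

Lemma act_AL b n : in_AL b -> act b n = act b 1 * n :> M.
Proof.
move=> bL; rewrite -[n in LHS]mul1r act_mul comul_ALr //; [|lin|lin].
rewrite -[RHS]act1 act_mul; apply: eq_tlift => u v; by rewrite actM.
Qed.

Lemma cmul_pre_ball m b a t' : in_AL b ->
  cmul_pre (balanced_gen m b a) t' = 0.
Proof.
move=> bL; rewrite /balanced_gen -scaleN1r addrC cmul_pre_linl scaleN1r.
apply/eqP; rewrite addrC subr_eq0; apply/eqP.
rewrite (tensE t') !(lin_tlift _ _ (cmul_pre_linr _)); apply: eq_tlift => n c.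
rewrite !cmul_preE comul_mul; [|lin|lin].
rewrite (comul_ALl bL); [|lin|lin].
rewrite -[in LHS](mul1r a) comul_mul; [|lin|lin].
do 2!apply: eq_tlift => ? ?.
by rewrite -!(mulrA b) actM (act_AL (act _ n) bL) !mulrA.
Qed.

Lemma rtimes_unit n x c :
  \Sw_(x1, x2 <- comul x) rtimes (n * act x1 1) (x2 * c) = rtimes n (x * c).
Proof.
rewrite -[in RHS](epsL_mul x).
have l : linear (fun y : A => rtimes n (y * c)).
  by apply: (comp_lin (rtimes_linr n)); lin.
rewrite (lin_tlift _ _ l); apply: eq_tlift => x1 x2.
by rewrite act_one rtimes_balanced ?mulrA //; exact: epsL_AL.
Qed.

Lemma rtimes_linl' (X : lmodType K) (a : A) (f : X -> M) :
  linear f -> linear (fun x => rtimes (f x) a).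
Proof. exact: comp_lin (rtimes_linl a). Qed.
Lemma rtimes_linr' (X : lmodType K) m (f : X -> A) :
  linear f -> linear (fun x => rtimes m (f x)).
Proof. exact: comp_lin (rtimes_linr m). Qed.

Ltac rlin := repeat first
  [ lazymatch goal with |- GRing.linear_for _ (fun x => rtimes _ _) =>
      first [apply: rtimes_linl' | apply: rtimes_linr']
    | |- GRing.linear_for _ (rtimes _) => exact: rtimes_linr end | lin1 ].

Lemma cmul_pre_balr m a n b c : in_AL b ->
  cproj (cmul_pre (m \ox a) ((n * act b 1) \ox c)) =
  cproj (cmul_pre (m \ox a) (n \ox (b * c))).
Proof.
move=> bL; rewrite !cmul_preE !(lin_tlift _ _ cproj_lin).
transitivity (\Sw_(x1, y <- comul a) \Sw_(x2, x3 <- comul y)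
   rtimes (m * act x1 n * act (x2 * b) 1) (x3 * c)).
  rewrite comul_assoc; [|rlin|rlin|rlin].
  apply: eq_tlift => y x3; rewrite act_mul.
  have l : linear (fun z : M => rtimes (m * z) (x3 * c)) by rlin.
  rewrite -/(rtimes _ _) (lin_tlift _ _ l); apply: eq_tlift => x1 x2.
  by rewrite actM mulrA.
apply: eq_tlift => x1 y; rewrite -/(rtimes _ _) mulrA -rtimes_unit.
rewrite (comul_mul (F := fun z1 z2 => rtimes (m * act x1 n * act z1 1) (z2 * c))); [|rlin|rlin].
rewrite -[in LHS](mulr1 y).
rewrite (comul_mul (F := fun x2 x3 => rtimes (m * act x1 n * act (x2 * b) 1) (x3 * c))); [|rlin|rlin].
apply: eq_tlift => y1 y2.
rewrite (comul_ALr (F := fun b1 b2 => rtimes (m * act x1 n * act (y1 * b1) 1) (y2 * b2 * c)) bL); [|rlin|rlin].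
by apply: eq_tlift => u v; rewrite !mulrA.
Qed.

Definition cmul (x y : crossed) : crossed := cproj (cmul_pre (crepr x) (crepr y)).

Lemma cmul_pre_balanced_l s t : balanced s -> cmul_pre s t = 0.
Proof.
move=> [ss [Hs ->]]; rewrite (lin_sum (cmul_pre_linl t)) big_seq big1 // => p pin.
by apply: cmul_pre_ball; apply: Hs.
Qed.

Lemma cmul_pre_balanced_r s t : balanced s -> cproj (cmul_pre t s) = 0.
Proof.
move=> [ss [Hs ->]].
have l := comp_lin cproj_lin (cmul_pre_linr t).
rewrite (lin_sum l) big_seq big1 // => p pin.
rewrite (tensE t) (lin_tlift _ _ (cmul_pre_linl _)) (lin_tlift _ _ cproj_lin).
apply: big1 => i _; rewrite /balanced_gen -scaleN1r addrC cmul_pre_linr.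
rewrite cproj_lin scaleN1r cmul_pre_balr ?addNr //.
exact: Hs.
Qed.

Lemma cmulE s t : cmul (cproj s) (cproj t) = cproj (cmul_pre s t).
Proof.
have bs : balanced (crepr (cproj s) - s) by apply/cproj_eq; rewrite creprK.
have bt : balanced (crepr (cproj t) - t) by apply/cproj_eq; rewrite creprK.
rewrite /cmul -[in LHS](subrK s (crepr (cproj s))) (linD (cmul_pre_linl _)).
rewrite cmul_pre_balanced_l // add0r.
rewrite -[in LHS](subrK t (crepr (cproj t))) (linD (cmul_pre_linr _)).
by rewrite (linD cproj_lin) cmul_pre_balanced_r // add0r.
Qed.

Lemma cmul_linl y : linear (cmul^~ y).
Proof.
move=> c s t; rewrite -[s]creprK -[t]creprK -[y]creprK -cproj_lin !cmulE.
by rewrite cmul_pre_linl cproj_lin.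
Qed.

Lemma cmul_linr x : linear (cmul x).
Proof.
move=> c s t; rewrite -[s]creprK -[t]creprK -[x]creprK -cproj_lin !cmulE.
by rewrite cmul_pre_linr cproj_lin.
Qed.

Lemma cmul_rtimes m a m' a' : cmul (rtimes m a) (rtimes m' a') =
  \Sw_(a1, a2 <- comul a) rtimes (m * act a1 m') (a2 * a').
Proof. by rewrite /rtimes cmulE cmul_preE (lin_tlift _ _ cproj_lin). Qed.

Lemma crossed_ext (X : lmodType K) (f g : crossed -> X) :
  linear f -> linear g ->
  (forall m a, f (rtimes m a) = g (rtimes m a)) -> f =1 g.
Proof.
move=> lf lg fg x; rewrite -[x]creprK (tensE (crepr x)).
rewrite (lin_tlift _ _ cproj_lin) (lin_tlift _ _ lf) (lin_tlift _ _ lg).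
by apply: eq_tlift => m a; apply: fg.
Qed.

Lemma cmulA : associative cmul.
Proof.
move=> x y z.
apply: (crossed_ext (f := fun x => cmul x (cmul y z))
                    (g := fun x => cmul (cmul x y) z)).
- exact: cmul_linl.
- exact: comp_lin (cmul_linl z) (cmul_linl y).
move=> m a.
apply: (crossed_ext (f := fun y => cmul (rtimes m a) (cmul y z))
                    (g := fun y => cmul (cmul (rtimes m a) y) z)).
- exact: comp_lin (cmul_linr _) (cmul_linl z).
- exact: comp_lin (cmul_linl z) (cmul_linr _).
move=> m' a'.
apply: (crossed_ext (f := fun z => cmul (rtimes m a) (cmul (rtimes m' a') z))
                    (g := fun z => cmul (cmul (rtimes m a) (rtimes m' a')) z)).
- exact: comp_lin (cmul_linr _) (cmul_linr _).
- exact: cmul_linr.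
move=> m'' a''.
rewrite !cmul_rtimes (lin_tlift _ _ (cmul_linr _)) (lin_tlift _ _ (cmul_linl _)).
under eq_tlift => a1 a2 do rewrite cmul_rtimes.
under [RHS]eq_tlift => a1 a2 do
  [rewrite cmul_rtimes (comul_mul (F := fun x1 x2 => rtimes (m * act a1 m' * act x1 m'') (x2 * a''))); [|rlin|rlin]].
rewrite tlift_exch comul_assoc; [|rlin|rlin|rlin].
apply: eq_tlift => y' x3.
rewrite tlift_exch; apply: eq_tlift => b1 b2.
have l : linear (fun z : M => rtimes (m * z) (x3 * (b2 * a''))) by rlin.
rewrite act_mul (lin_tlift _ _ l); apply: eq_tlift => x1 x2.
by rewrite actM !mulrA.
Qed.

Lemma cmul1l : left_id (rtimes 1 1) cmul.
Proof.
apply: (crossed_ext (cmul_linr _)) => [|m a]; first by [].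
rewrite cmul_rtimes.
have [v [vL vE]] := comul1_AL A.
rewrite vE; [|rlin|rlin].
have l : linear (fun z : M => rtimes z a) by rlin.
rewrite -[m in RHS]mulr1 -[m * 1 in RHS]act1 act_mul vE; [|lin|lin].
rewrite (lin_sum l); apply: eq_bigr => j _.
by rewrite rtimes_balanced // mul1r.
Qed.

Lemma cmul1r : right_id (rtimes 1 1) cmul.
Proof.
apply: (crossed_ext (cmul_linl _)) => [|m a]; first by [].
by rewrite cmul_rtimes rtimes_unit mulr1.
Qed.

Lemma cmulDl : left_distributive cmul +%R.
Proof. by move=> x y z; rewrite (linD (cmul_linl z)). Qed.

Lemma cmulDr : right_distributive cmul +%R.
Proof. by move=> x y z; rewrite (linD (cmul_linr x)). Qed.

HB.instance Definition _ := GRing.Zmodule_isPzRing.Build crossed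
  cmulA cmul1l cmul1r cmulDl cmulDr.

Lemma rtimesM m a m' a' : rtimes m a * rtimes m' a' =
  \Sw_(a1, a2 <- comul a) rtimes (m * act a1 m') (a2 * a').
Proof. exact: cmul_rtimes. Qed.

End CrossedProduct.

Section Integrals.
Variables (R : realType) (A : weakHopfType R).
Local Notation K := R[i].
Local Notation dual := 'Hom(A, K^o).

Definition dual_mul (psi phi : dual) : dual :=
  linfun (fun x => \Sw_(x1, x2 <- comul x) ((psi x1 : K) * phi x2) : K^o).

Definition dual_star (psi : dual) : dual :=
  linfun (fun x => (psi (lstar x) : K)^* : K^o).

(* <a -> phi | b> = <phi | b a> *)
Definition dual_act (a : A) (phi : dual) : dual := linfun (fun b => phi (b * a)).

Lemma dual_mulE psi phi x :
  dual_mul psi phi x = \Sw_(x1, x2 <- comul x) ((psi x1 : K) * phi x2) :> K.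
Proof.
apply: (linfun_lin (f := fun x : A => _ : K^o)).
apply: tliftt_lin => [|v c y z]; first exact: lfun_lin.
by rewrite linearP mulrDl -mulrA.
Qed.

Lemma dual_starE psi x : dual_star psi x = (psi (lstar x) : K)^* :> K.
Proof.
apply: (linfun_lin (f := fun x : A => _ : K^o)) => c y z.
rewrite /lstar linearP (star_anti (B := A)) linearP.
by rewrite rmorphD rmorphM /= conjCK.
Qed.

Lemma dual_actE a phi b : dual_act a phi b = phi (b * a).
Proof.
by apply: (linfun_lin (f := fun b : A => phi (b * a))); lin.
Qed.

Definition left_integral (l : A) : Prop := forall a, a * l = epsL a * l.

Definition right_integral (l : A) : Prop := forall a, l * a = l * epsR a.

Definition haar_integral (h : A) : Prop :=
  [/\ left_integral h, right_integral h, epsR h = 1 & epsL h = 1].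

Definition positive_functional (x : A) : Prop :=
  forall phi : dual, 0 <= (dual_mul (dual_star phi) phi x : K).

Definition normalized_integral (l : A) : Prop := dual_act l counit = counit.

Definition nondegenerate_functional (x : A) : Prop :=
  (forall phi, (forall psi, dual_mul phi psi x = 0) -> phi = 0) /\
  (forall psi, (forall phi, dual_mul phi psi x = 0) -> psi = 0).

Definition nL (l : A) : A := \Sw_(l1, l2 <- comul l) (l1 * antipode l2).

Definition nR (l : A) : A :=
  \Sw_(l1, l2 <- comul l) (l2 * (antipode^-1)%VF l1).

Definition dR (l : A) : A := \Sw_(l1, l2 <- comul l) (antipode l1 * l2).

Definition cpos (x : A) : Prop := exists y : A, x = star y * y.

(* The positive square root (0 if there is none). *)
Definition csqrt (x : A) : A := xget 0 [set s | cpos s /\ s * s = x]%classic.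

Definition is_projection (p : A) : Prop := star p = p /\ p * p = p.

Definition jones_element (h l : A) : A := csqrt (dR l) * h * csqrt (dR l).

Variable M : moduleAlgType A.

Definition act_invariant (n : M) : Prop := forall a, act a n = act (epsL a) n.

Definition cond_exp (l : A) (m : M) : M := act l m.

Lemma cond_exp_invariant l m : left_integral l -> act_invariant (cond_exp l m).
Proof. by move=> lI a; rewrite /cond_exp -!actM lI. Qed.

Definition crossed_M (m : M) : crossed M := rtimes m 1.

Definition crossed_A (a : A) : crossed M := rtimes 1 a.

End Integrals.

(* Main.v *)
Require Import Defs.
From mathcomp Require Import all_boot all_order all_algebra all_field.
From mathcomp Require Import boolp classical_sets reals complex.
From mathcomp Require Import ring.

Set Implicit Arguments.
Unset Strict Implicit.
Unset Printing Implicit Defensive.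
Import Order.TTheory GRing.Theory Num.Theory.
Local Open Scope ring_scope.

(* Let x = d_R(l)^{1/2}, an element of A_R. Since h is a two-sided integral with
   eps_L(h) = 1, l = h l = h d_R(l) = h x x. In the crossed product A_R commutes
   with M and a m h = (a |> m) h, so e m e = x (h x x) m h x = x (l m h) x = E_l(m) e.
   For r in A_R, h r h = h E(r) with E(r) in A_R central; hence
   e e = x l h x = n_L(l) e = E(d_R(l)) e, and n_R(l) = E(d_R(l)). Injectivity of
   x |-> x h x on positive elements of A_R, which is (ii), follows from computations
   with E. If l or e is nondegenerate then x is invertible, and their bilinear forms
   differ by the automorphism psi |-> psi(x . x^{-1}) of the dual.

   Positivity of d_R(l) and the functional calculus rest on minimal projections p:
   p A p = C p, and an element d is positive iff p d p >= 0 for all of them. *)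

(** * Spectral theory of finite-dimensional C*-algebras *)

Section FinDimCStar.
Variables (R : realType) (A : cstarAlgType R).
Local Notation K := R[i].
Implicit Types (a b d e p u v : A) (f g : {poly R}).

(** Coefficients are real although [A] is complex, so that a self-adjoint [a] has self-adjoint
    values [pev a f]. *)
Definition pev a f : A := horner_alg a (map_poly (real_complex R) f).

Lemma pevM a f g : pev a (f * g) = pev a f * pev a g.
Proof. by rewrite /pev !rmorphM. Qed.
Lemma pevD a f g : pev a (f + g) = pev a f + pev a g.
Proof. by rewrite /pev !rmorphD. Qed.
Lemma pevB a f g : pev a (f - g) = pev a f - pev a g.
Proof. by rewrite /pev !rmorphB. Qed.
Lemma pevX a : pev a 'X = a.
Proof. by rewrite /pev map_polyX horner_algX. Qed.
Lemma pevC a (c : R) : pev a c%:P = c%:C%C%:A.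
Proof. by rewrite /pev map_polyC horner_algC. Qed.
Lemma pev_comm a f g : pev a f * pev a g = pev a g * pev a f.
Proof. by rewrite -!pevM mulrC. Qed.

Lemma pev_ind a (P : A -> Prop) : P 1 -> (forall (c : K) x y, P x -> P y -> P (c *: x + y)) ->
  (forall x, P x -> P (x * a)) -> forall f, P (pev a f).
Proof.
move=> P1 PD PM; elim/poly_ind => [|f c IH].
  by have := PD (-1) _ _ P1 P1; rewrite scaleN1r addNr /pev !rmorph0.
by rewrite pevD pevM pevX pevC addrC; apply: PD => //; apply: PM.
Qed.

Lemma pev_commr a b f : a * b = b * a -> pev a f * b = b * pev a f.
Proof.
move=> ab; apply: (pev_ind (P := fun x => x * b = b * x)).
- by rewrite mul1r mulr1.
- by move=> c x y hx hy; rewrite mulrDl mulrDr -scalerAl -scalerAr hx hy.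
by move=> x hx; rewrite -mulrA ab mulrA hx mulrA.
Qed.

Lemma pev_star a f : star a = a -> star (pev a f) = pev a f.
Proof.
move=> sa; elim/poly_ind: f => [|f c IH].
  by rewrite /pev !rmorph0 (anti_lin0 (@star_anti R A)).
rewrite pevD pevM pevC starD starM starZ star1 IH pevX sa conj_Creal; last first.
  by apply/complex_realP; exists c.
by rewrite -[X in X * pev a f]pevX pev_comm pevX.
Qed.

Lemma pev_eigen a v r f : a * v = r%:C%C *: v -> pev a f * v = (f.[r])%:C%C *: v.
Proof.
move=> av; elim/poly_ind: f => [|f c IH].
  by rewrite /pev !rmorph0 horner0 mul0r scale0r.
rewrite pevD pevM pevC pevX mulrDl -mulrA av -scalerAr IH hornerMXaddC.
by rewrite -scalerAl mul1r scalerA -scalerDl -!rmorphM -rmorphD /= mulrC.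
Qed.

Lemma star0 : star (0 : A) = 0.
Proof. exact: anti_lin0 (@star_anti R A). Qed.
Lemma starN a : star (- a) = - star a.
Proof. by rewrite -scaleN1r starZ rmorphN1 scaleN1r. Qed.
Lemma starB a b : star (a - b) = star a - star b.
Proof. by rewrite starD starN. Qed.
Lemma starZr (c : R) a : star (c%:C%C *: a) = c%:C%C *: star a.
Proof. by rewrite starZ conj_Creal //; apply/complex_realP; exists c. Qed.

(** The C*-identity makes the norm of [a] vanish. Later arguments use the norm only through this
    cancellation. *)
Lemma star_mul_eq0 a : star a * a = 0 -> a = 0.
Proof.
move=> aa; have n0 : cnorm (0 : A) = 0.
  by have := cnormZ 0 (0 : A); rewrite scale0r normr0 mul0r => -[].
by apply/cnorm0_eq0/eqP; rewrite -sqrf_eq0 -cnorm_star aa n0.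
Qed.

Definition proj p := star p = p /\ p * p = p.

Lemma uniq_remP (T : eqType) (s : seq T) :
  (forall z, z \in s -> z \notin rem z s) -> uniq s.
Proof.
elim: s => //= y s IH H; have ys : y \notin s.
  by have := H y (mem_head _ _); rewrite eqxx.
rewrite ys; apply: IH => z zs; have := H z; rewrite inE zs orbT => /(_ isT).
have /negPf -> : y != z by apply: contraNneq ys => ->.
by rewrite inE negb_or => /andP[].
Qed.

(* The set of roots is that of a factored annihilator of minimal length, so
   every root r has a nonzero eigenvector v; v^* v <> 0 makes r real and simple. *)
Lemma spectrum a e : star a = a -> proj e -> e != 0 -> a * e = e * a ->
  exists rs : seq R, [/\ uniq rs, pev a (\prod_(r <- rs) ('X - r%:P)) * e = 0 &
    forall r, r \in rs -> exists p, [/\ proj p, p != 0, p * e = p & a * p = r%:C%C *: p]].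
Proof.
move=> sa [se ee] e0 ae.
pose ev s := horner_alg a (\prod_(z <- s) ('X - (z : K)%:P)).
have evc s : ev s * e = e * ev s.
  rewrite /ev; elim: s => [|z s IH].
    by rewrite big_nil rmorph1 mul1r mulr1.
  rewrite big_cons rmorphM rmorphB /= horner_algX horner_algC -mulrA IH !mulrA.
  by rewrite mulrBl mulrBr ae -scalerAl -scalerAr mulr1 mul1r.
have evcons z s : ev (z :: s) = (a - z%:A) * ev s.
  by rewrite /ev big_cons rmorphM rmorphB /= horner_algX horner_algC.
have [n0 [s0 sz0 s0P]] : exists n, exists2 s, size s = n & ev s * e = 0.
  (* The n + 1 powers 1, a, ..., a^n are linearly dependent in dimension n. The linear factors of
     the resulting annihilator over the algebraically closed [K] form a first annihilating list. *)
  have [p p0 pe] : exists2 p : {poly K}, p != 0 & horner_alg a p = 0.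
    pose n := \dim {:A}.
    pose F (w : 'rV[K]_n.+1) : A := horner_alg a (rVpoly w).
    have lF : linear F.
      by move=> c x y; rewrite /F linearP linearP /= mulr_algl.
    pose FF := linfun F.
    have FE w : FF w = F w by apply: linfun_lin.
    have : lker FF != 0%VS.
      apply/eqP => k0; have := limg_ker_dim FF fullv.
      rewrite k0 capv0 dimv0 add0n dimvf /dim /= mul1n => E.
      have := dimvS (subvf (limg FF)); rewrite E -/n.
      by rewrite ltnn.
    rewrite -vpick0; have := memv_pick (lker FF); set w := vpick _.
    rewrite memv_ker FE => /eqP wk w0; exists (rVpoly w); last exact: wk.
    by apply: contra w0 => /eqP w0; rewrite -[w]rVpolyK w0 linear0.
  have [s ps] := closed_field_poly_normal p.
  exists (size s), s => //; rewrite /ev.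
  have lc : lead_coef p != 0 by rewrite lead_coef_eq0.
  have : lead_coef p *: horner_alg a (\prod_(z <- s) ('X - z%:P)) = 0.
    by rewrite -[RHS]pe [in RHS]ps linearZ /= mulr_algl.
  move/eqP; rewrite scaler_eq0 (negPf lc) /= => /eqP ->; exact: mul0r.
pose Q n := `[< exists2 s, size s = n & ev s * e = 0 >].
have exQ : exists n, Q n by exists n0; apply/asboolP; exists s0.
case: (ex_minnP exQ) => n /asboolP[s sn sP] nmin {n0 s0 sz0 s0P exQ}.
have perm_ev s1 s2 : perm_eq s1 s2 -> ev s1 = ev s2.
  by move=> h; rewrite /ev (perm_big _ h).
have evrem z : z \in s -> ev s = (a - z%:A) * ev (rem z s).
  by move=> zs; rewrite -evcons; apply/perm_ev/perm_to_rem.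
have rem0 z : z \in s -> ev (rem z s) * e != 0.
  move=> zs; apply/eqP => h; have := nmin (size (rem z s)).
  rewrite size_rem // sn => H; have : Q n.-1.
    by apply/asboolP; exists (rem z s); rewrite ?size_rem ?sn.
  move/H; have : (0 < n)%N by rewrite -sn; case: (s) zs.
  by case: (n) => // k _; rewrite ltnn.
have eig z : z \in s -> a * (ev (rem z s) * e) = z *: (ev (rem z s) * e).
  move=> zs; have := sP; rewrite (evrem z zs) -mulrA mulrBl -scalerAl mul1r.
  by move/eqP; rewrite subr_eq0 => /eqP.
have real z : z \in s -> exists r, z = r%:C%C.
  move=> zs; apply/complex_realP/CrealP.
  have := eig z zs; have := rem0 z zs; move: (_ * e) => v v0 av.
  have : star v * (a * v) = star (a * v) * v by rewrite starM sa mulrA.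
  rewrite av starZ -scalerAr -scalerAl => /eqP.
  rewrite -subr_eq0 -scalerBl scaler_eq0 subr_eq0 => /orP[/eqP //|/eqP h].
  by rewrite (star_mul_eq0 h) eqxx in v0.
have us : uniq s.
  apply: uniq_remP => z zs; apply/negP => zr.
  have [r zE] := real z zs; have := rem0 z zs.
  set t := rem z (rem z s); have evt : ev (rem z s) = (a - z%:A) * ev t.
    by rewrite -evcons; apply/perm_ev/perm_to_rem.
  have sz : star (a - z%:A) = a - z%:A.
    by rewrite starB sa zE starZr star1.
  rewrite evt -mulrA; set w := ev t * e; move/eqP; apply; apply: star_mul_eq0.
  rewrite starM sz -!mulrA [X in _ * X](_ : _ = 0) ?mulr0 //.
  by rewrite /w [_ * (ev t * e)]mulrA -evt mulrA -(evrem z zs) sP.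
exists [seq complex.Re z | z <- s].
have sE : [seq r%:C%C | r <- [seq complex.Re z | z <- s]] = s.
  rewrite -map_comp -[RHS]map_id; apply/eq_in_map => z zs /=.
  by have [r ->] := real z zs.
have evE rs : pev a (\prod_(r <- rs) ('X - r%:P)) = ev [seq r%:C%C | r <- rs].
  rewrite /pev /ev rmorph_prod big_map; congr (horner_alg a _).
  by apply: eq_bigr => r _; rewrite rmorphB /= map_polyX map_polyC.
have {}us : uniq [seq complex.Re z | z <- s].
  by apply: (map_uniq (f := fun r => r%:C%C)); rewrite sE.
move: [seq complex.Re z | z <- s] sE us => rs sE us.
split=> [//||r rr]; first by rewrite evE sE.
have zs : r%:C%C \in s by rewrite -sE (map_f (fun r => r%:C%C)).
(* Lagrange interpolation: [pev a q * e] is an eigenvector for r, on which [pev a q] acts as q.[r],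
   nonzero since the roots are distinct. Dividing by q.[r] makes it idempotent. *)
set q := \prod_(r' <- rem r rs) ('X - r'%:P).
have qE : pev a q = ev (rem r%:C%C s).
  rewrite evE; apply: perm_ev; rewrite -(perm_cons r%:C%C).
  rewrite -(permPr (perm_to_rem zs)) -sE -[_ :: _]/[seq r%:C%C | r <- r :: rem r rs].
  by apply: perm_map; rewrite perm_sym perm_to_rem.
have av := eig _ zs; have v0 := rem0 _ zs; rewrite -qE in av v0.
have qr : q.[r] != 0.
  rewrite horner_prod prodf_seq_neq0; apply/allP => r' /=.
  by rewrite mem_rem_uniq // !inE hornerXsubC subr_eq0 eq_sym => /andP[].
have ce : pev a q * e = e * pev a q by rewrite pev_commr.
have qv := pev_eigen q av.
exists ((q.[r]^-1)%:C%C *: (pev a q * e)); split.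
- split; first by rewrite starZr starM se pev_star // -ce.
  rewrite -scalerAl -scalerAr {1}ce -mulrA qv -scalerAr mulrA -ce -mulrA ee.
  rewrite !scalerA -!rmorphM /=.
  by rewrite mulVf // mulr1.
- by rewrite scaler_eq0 negb_or v0 andbT fmorph_eq0 invr_eq0.
- by rewrite -scalerAl -mulrA ee.
by rewrite -scalerAr av !scalerA mulrC.
Qed.
End FinDimCStar.

(** * Minimal projections and their one-dimensional corners *)

Section MinimalProjections.
Variables (R : realType) (A : cstarAlgType R).
Local Notation K := R[i].
Implicit Types (a b d e p q u v x : A) (f g : {poly R}).

(** The order q <= p of projections is encoded as [q * p = q]. *)
Definition min_proj p :=
  [/\ proj p, p != 0 & forall q, proj q -> q * p = q -> q = 0 \/ q = p].

Lemma projC p q : proj p -> proj q -> q * p = q -> p * q = q.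
Proof. by move=> [sp _] [sq _] /(congr1 (@star R A)); rewrite starM sp sq. Qed.

(** The right ideal qA lies in pA, and equality would give p = q p = q. This dimension is the
    measure for inductions on projections. *)
Lemma proj_dim_lt p q : proj p -> proj q -> q * p = q -> q != p ->
  (\dim (limg (amull q)) < \dim (limg (amull p)))%N.
Proof.
move=> pp pq qp np; have sub : (limg (amull q) <= limg (amull p))%VS.
  apply/subvP => _ /memv_imgP[x _ ->]; apply/memv_imgP; exists (q * x); rewrite ?memvf //.
  by rewrite !lfunE /= mulrA (projC pp pq qp).
rewrite ltn_neqAle dimvS // andbT (dimv_leqif_sup sub).
apply: contra np => /subvP/(_ p)/=.
have -> : p \in limg (amull p).
  by apply/memv_imgP; exists 1; rewrite ?memvf // lfunE /= mulr1.
move=> /(_ isT).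
move=> /memv_imgP[x _]; rewrite lfunE /= => pE; apply/eqP.
by rewrite -qp pE mulrA (proj2 pq).
Qed.

Lemma exists_min_proj e : proj e -> e != 0 -> exists2 p, min_proj p & p * e = p.
Proof.
have [n] := ubnP (\dim (limg (amull e))); elim: n e => // n IH e le pe e0.
have [me|] := pselect (min_proj e); first by exists e => //; case: pe.
move=> nm; have [q [pq qe q0 qn]] : exists q, [/\ proj q, q * e = q, q != 0 & q != e].
  apply: contrapT => nq; apply: nm; split=> // q pq qe.
  have [->|q0] := eqVneq q 0; first by left.
  have [->|qn] := eqVneq q e; first by right.
  by case: nq; exists q.
have [|p mp pq'] := IH q _ pq q0.
  by apply: leq_trans (proj_dim_lt pe pq qe qn) _.
by exists p => //; rewrite -pq' -mulrA qe.
Qed.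

(** An eigenprojection of [a] below p is nonzero, hence equals p by minimality, so a = a p is a
    multiple of p. *)
Lemma min_proj_sa p a : min_proj p -> star a = a -> a * p = a ->
  exists r : R, a = r%:C%C *: p.
Proof.
move=> [pp p0 mp] sa ap.
have pa : p * a = a by have := congr1 (@star R A) ap; rewrite starM sa (proj1 pp).
have [|rs [_ H0 H]] := spectrum sa pp p0; first by rewrite ap pa.
case: rs H0 H => [|r rs] H0 H.
  by move: H0; rewrite big_nil (pevC a 1) scale1r mul1r => h; rewrite h eqxx in p0.
have [q [pq q0 qp aq]] := H r (mem_head _ _).
case: (mp q pq qp) => [h|qE]; first by rewrite h eqxx in q0.
by exists r; rewrite -{1}ap -qE aq.
Qed.

Lemma min_proj_scal p a : min_proj p -> exists c : K, p * a * p = c *: p.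
Proof.
move=> mp; have [[sp pp] _ _] := mp.
pose b := p * a * p; have bp : b * p = b by rewrite /b -mulrA pp.
have pb : p * b = b by rewrite /b !mulrA pp.
have sbp : star b * p = star b by rewrite -{1}sp -starM pb.
have [||r rE] := @min_proj_sa p (b + star b) mp.
- by rewrite starD starK addrC.
- by rewrite mulrDl bp sbp.
have [||s sE] := @min_proj_sa p ('i *: (b - star b)) mp.
- by rewrite starZ conjCi starB starK scaleNr -scalerN opprB.
- by rewrite -scalerAl mulrBl bp sbp.
have h2 : (2%:R : K) != 0 by rewrite pnatr_eq0.
(* Twice b is the sum of b + star b and -i times i (b - star b), two self-adjoint elements of
   pAp. *)
exists (2%:R^-1 * (r%:C%C - 'i * s%:C%C)).
rewrite -/b -scalerA scalerBl -rE -scalerA -sE scalerA -expr2 sqrCi scaleN1r opprK.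
by rewrite addrACA subrr addr0 -mulr2n -[b *+ 2](scaler_nat 2) scalerA mulVf // scale1r.
Qed.

(* If the scalar c were negative, c p + t (p v p + (p v p)^* ) + t^2 p = 0 would have
   a real solution t; as the left-hand side is ((v + t) p)^* ((v + t) p), this gives
   v p = - t p and c = t^2. *)
Lemma min_proj_ge0 p v : min_proj p ->
  exists2 c : R, 0 <= c & star (v * p) * (v * p) = c%:C%C *: p.
Proof.
move=> mp; have [[sp pp] p0 _] := mp.
have [||c cE] := @min_proj_sa p (star (v * p) * (v * p)) mp.
- by rewrite starM starK.
- by rewrite -mulrA -[v * p * p]mulrA pp.
exists c => //; rewrite leNgt; apply/negP => c0.
have [||m mE] := @min_proj_sa p (p * v * p + star (p * v * p)) mp.
- by rewrite starD starK addrC.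
- by rewrite mulrDl -mulrA pp !starM sp -!mulrA pp.
pose t := (- m + Num.sqrt (m ^+ 2 - c *+ 4)) / 2.
have tE : c + t * m + t ^+ 2 = 0.
  have : 0 <= m ^+ 2 - c *+ 4.
    by rewrite addr_ge0 ?sqr_ge0 // oppr_ge0 mulrn_wle0 // ltW.
  move/sqr_sqrtr; rewrite /t; set s := Num.sqrt _ => sE.
  have : 4 * (c + (- m + s) / 2 * m + ((- m + s) / 2) ^+ 2) = 0.
    by rewrite -mulr_natr in sE; field: sE.
  by move/eqP; rewrite mulf_eq0 pnatr_eq0 /= => /eqP.
have h : star (v * p + t%:C%C *: p) * (v * p + t%:C%C *: p) = 0.
  have mE' : star (v * p) * p + p * (v * p) = m%:C%C *: p.
    by rewrite -mE addrC !starM sp !mulrA.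
  rewrite starD starZr sp mulrDl !mulrDr -!scalerAl -!scalerAr pp cE.
  rewrite addrA -(addrA (c%:C%C *: p)) -scalerDr mE' !scalerA.
  by rewrite -!scalerDl -!rmorphM -!rmorphD -expr2 tE scale0r.
have vE : v * p = - (t%:C%C *: p) by apply/eqP; rewrite -addr_eq0 (star_mul_eq0 h).
have : c%:C%C *: p = (t ^+ 2)%:C%C *: p.
  by rewrite -cE vE starN starZr sp mulNr mulrN opprK -scalerAl -scalerAr pp scalerA -rmorphM expr2.
move/eqP; rewrite -subr_eq0 -scalerBl scaler_eq0 (negPf p0) orbF -rmorphB /=.
rewrite fmorph_eq0 subr_eq0 => /eqP cE'.
by rewrite cE' ltNge sqr_ge0 in c0.
Qed.
End MinimalProjections.

(** * Positivity tested on minimal projections, and square roots *)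

Section Positivity.
Variables (R : realType) (A : weakHopfType R).
Local Notation K := R[i].
Implicit Types (a b d e p q s t u v x : A) (f g : {poly R}).

(** A positivity criterion that presupposes no factorization of d; [pos_on_min_sqrt] derives a
    square root from it. *)
Definition pos_on_min d := forall p, min_proj p ->
  exists2 c : R, 0 <= c & p * d * p = c%:C%C *: p.

Lemma cpos_pos_on_min d : cpos d -> pos_on_min d.
Proof.
move=> [y ->] p mp; have [[sp _] _ _] := mp.
have [c c0 cE] := min_proj_ge0 y mp; exists c => //.
by rewrite -cE starM sp !mulrA.
Qed.

(** Below each eigenprojection of d lies a minimal p, and p d p = r p recovers the eigenvalue r,
    which therefore satisfies [P]. The uses take [P] to be nonnegativity or being 0. *)
Lemma min_proj_roots (P : R -> Prop) d : star d = d ->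
    (forall p, min_proj p -> exists2 c : R, P c & p * d * p = c%:C%C *: p) ->
  exists rs : seq R, [/\ uniq rs, forall r, r \in rs -> P r &
    pev d (\prod_(r <- rs) ('X - r%:P)) = 0].
Proof.
move=> sd pd; have p1 : proj (1 : A) by split; rewrite ?star1 ?mulr1.
have [|rs [us r0 H]] := spectrum sd p1 (oner_neq0 A); first by rewrite mulr1 mul1r.
exists rs; split=> [//|r /H[e [pe e0 _ de]]|]; last by rewrite -[LHS]mulr1.
have [p mp pe'] := exists_min_proj pe e0.
have [[sp pp] p0 _] := mp; have [c c0 cE] := pd p mp.
have ep : e * p = p by have := congr1 (@star R A) pe'; rewrite starM sp (proj1 pe).
have : p * d * p = r%:C%C *: p.
  by rewrite -mulrA -[in LHS]ep (mulrA d) de -scalerAl ep -scalerAr pp.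
rewrite cE => /eqP; rewrite -subr_eq0 -scalerBl scaler_eq0 (negPf p0) orbF.
by rewrite -rmorphB fmorph_eq0 subr_eq0 => /eqP <-.
Qed.

Lemma vanish_pev d f (rs : seq R) : uniq rs ->
  pev d (\prod_(r <- rs) ('X - r%:P)) = 0 -> (forall r, r \in rs -> f.[r] = 0) ->
  pev d f = 0.
Proof.
move=> us d0 fr; have /dvdpP[g ->] : \prod_(r <- rs) ('X - r%:P) %| f.
  by apply: uniq_roots_dvdp; rewrite ?uniq_rootsE //; apply/allP => r /fr/eqP.
by rewrite pevM d0 mulr0.
Qed.

Lemma min_proj_eq0 d : star d = d -> (forall p, min_proj p -> p * d * p = 0) -> d = 0.
Proof.
move=> sd pd; have [p mp|rs [us rs0 dE]] := @min_proj_roots (eq 0) d sd.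
  by exists 0; rewrite ?scale0r ?pd.
by rewrite -(pevX d); apply: (vanish_pev us dE) => r /rs0 <-; rewrite hornerX.
Qed.

Lemma pos_on_min_roots d : star d = d -> pos_on_min d ->
  exists rs : seq R, [/\ uniq rs, forall r, r \in rs -> 0 <= r &
    pev d (\prod_(r <- rs) ('X - r%:P)) = 0].
Proof. exact: min_proj_roots. Qed.

(** The compressions of d are real, so those of the self-adjoint element i (d - star d) vanish, and
    compressions detect zero. *)
Lemma pos_on_min_sa d : pos_on_min d -> star d = d.
Proof.
move=> pd; have : 'i *: (d - star d) = 0.
  apply: min_proj_eq0 => [|p mp].
    by rewrite starZ conjCi starB starK scaleNr -scalerN opprB.
  have [[sp pp] p0 _] := mp; have [c _ cE] := pd p mp.
  have := congr1 (@star R A) cE; rewrite !starM starZr sp mulrA => cE'.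
  by rewrite -scalerAr -scalerAl mulrBr mulrBl cE cE' subrr scaler0.
by move/eqP; rewrite scaler_eq0 (negPf (neq0Ci _)) subr_eq0 => /eqP.
Qed.

(** Newton's scheme: a new point r is served by adding a multiple of the product [g] that vanishes
    at the earlier points. *)
Lemma interpolation (F : fieldType) (rs : seq F) (y : F -> F) :
  exists f : {poly F}, forall r, r \in rs -> f.[r] = y r.
Proof.
elim: rs => [|r rs [f fE]]; first by exists 0.
have [rin|rn] := boolP (r \in rs).
  by exists f => r'; rewrite inE => /orP[/eqP ->|]; exact: fE.
pose g := \prod_(z <- rs) ('X - z%:P).
have gr : g.[r] != 0.
  rewrite horner_prod prodf_seq_neq0; apply/allP => z zs /=.
  by rewrite hornerXsubC subr_eq0; apply: contraNneq rn => ->.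
exists (f + ((y r - f.[r]) / g.[r])%:P * g) => r'.
rewrite inE hornerD hornerM hornerC => /orP[/eqP ->|rin].
  by rewrite divfK // addrC subrK.
have -> : g.[r'] = 0 by apply/eqP; rewrite -/(root g r') root_prod_XsubC.
by rewrite mulr0 addr0 fE.
Qed.

Lemma pev_id_on d f (rs : seq R) : uniq rs ->
  pev d (\prod_(r <- rs) ('X - r%:P)) = 0 -> (forall r, r \in rs -> f.[r] = r) ->
  pev d f = d.
Proof.
move=> us d0 fr; apply/eqP; rewrite -subr_eq0 -{2}(pevX d) -pevB.
apply/eqP/(vanish_pev us d0) => r rin.
by rewrite hornerD hornerN hornerX fr // subrr.
Qed.

Lemma pev_comp d f g : pev (pev d g) f = pev d (f \Po g).
Proof.
elim/poly_ind: f => [|f c IH]; first by rewrite comp_poly0 /pev !rmorph0.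
by rewrite !comp_polyD comp_polyM comp_polyX comp_polyC !pevD !pevM pevX !pevC IH.
Qed.

Lemma cpos_star s : cpos s -> star s = s.
Proof. by move=> [y ->]; rewrite starM starK. Qed.

(* Both s and t equal f (s * s) for one polynomial f computing square roots on
   their joint spectrum. *)
Lemma cpos_sqrt_uniq s t : cpos s -> cpos t -> s * s = t * t -> s = t.
Proof.
move=> ps pt st.
have [rs [us rs0 sE]] := pos_on_min_roots (cpos_star ps) (cpos_pos_on_min ps).
have [ts [ut ts0 tE]] := pos_on_min_roots (cpos_star pt) (cpos_pos_on_min pt).
have [f fE] := interpolation ([seq r ^+ 2 | r <- rs ++ ts]) Num.sqrt.
have key u (xs : seq R) : {subset xs <= rs ++ ts} -> uniq xs -> (forall r, r \in xs -> 0 <= r) ->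
    pev u (\prod_(r <- xs) ('X - r%:P)) = 0 -> pev (u * u) f = u.
  move=> sub uu u0 uE; rewrite -{1 2}(pevX u) -pevM pev_comp.
  apply: (pev_id_on uu uE) => r rin; rewrite horner_comp -expr2 hornerXn fE.
    by rewrite sqrtr_sqr ger0_norm //; exact: u0.
  by apply: map_f; apply: sub.
rewrite -(key s rs) // ?st ?(key t ts) // => r; rewrite mem_cat => ->//.
by rewrite orbT.
Qed.

Lemma pos_on_min_sqrt d : pos_on_min d -> exists f,
  cpos (pev d f) /\ pev d f * pev d f = d.
Proof.
move=> pd; have sd := pos_on_min_sa pd; have [rs [us rs0 dE]] := pos_on_min_roots sd pd.
(* A polynomial for fourth roots: its value at d is self-adjoint, so the square of that value is
   visibly positive, and it is a square root of d. *)
have [f fE] := interpolation rs (fun r => Num.sqrt (Num.sqrt r)).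
exists (f * f); split; first by exists (pev d f); rewrite pevM pev_star.
rewrite -pevM; apply: (pev_id_on us dE) => r rin.
by rewrite !hornerM fE // -!expr2 !sqr_sqrtr ?sqrtr_ge0 ?rs0.
Qed.

(** A root exists, so [xget] does not return its default 0. By uniqueness the chosen root is a
    polynomial in d and stays in every unital subalgebra containing d. *)
Lemma csqrtP d : pos_on_min d ->
  [/\ exists f, csqrt d = pev d f, cpos (csqrt d) & csqrt d * csqrt d = d].
Proof.
move=> pd; have [f [fp fs]] := pos_on_min_sqrt pd.
have [cp cs] : cpos (csqrt d) /\ csqrt d * csqrt d = d.
  by rewrite /csqrt; case: xgetP => [x _ //|/(_ (pev d f))]; case.
split=> //; exists f; apply: cpos_sqrt_uniq => //; by rewrite cs fs.
Qed.

(** A minimal projection compresses the sum to c + c' = 0 with c and c' nonnegative, so every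
    compression of [star a * a] vanishes. *)
Lemma sum_squares_eq0 a b : star a * a + star b * b = 0 -> a = 0.
Proof.
move=> ab; apply: star_mul_eq0.
have pa : cpos (star a * a) by exists a.
apply: min_proj_eq0 => [|p mp]; first exact: cpos_star.
have [c c0 cE] := cpos_pos_on_min pa mp.
have [|c' c0' cE'] := @cpos_pos_on_min (star b * b) _ p mp; first by exists b.
have [_ p0 _] := mp.
have : p * (star a * a + star b * b) * p = (c + c')%:C%C *: p.
  by rewrite mulrDr mulrDl cE cE' -scalerDl -rmorphD.
rewrite ab mulr0 mul0r => /esym/eqP; rewrite scaler_eq0 (negPf p0) orbF fmorph_eq0.
by rewrite paddr_eq0 // => /andP[/eqP c00 _]; rewrite cE c00 scale0r.
Qed.
End Positivity.

(** * Resolving the left ideal Ap by partial isometries *)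

Section Resolution.
Variables (R : realType) (A : cstarAlgType R).
Local Notation K := R[i].

Lemma proj1B (q : A) : proj q -> proj (1 - q).
Proof.
move=> [sq qq]; split; first by rewrite starB star1 sq.
by rewrite mulrBl mul1r mulrBr mulr1 qq subrr subr0.
Qed.

(** The list consists of partial isometries u with [star u * u = p] whose ranges exhaust Ap. The
    projection [q] collects the [u * star u] found so far, and the induction runs on the dimension
    of (1 - q)A. *)
Lemma min_proj_resolution (p : A) : min_proj p -> exists us : seq A,
  (forall u, u \in us -> u * p = u) /\
  forall v, v * p = \sum_(u <- us) u * (star u * v * p).
Proof.
move=> mp; have [[sp pp] p0 _] := mp.
suff H q : proj q -> exists us : seq A, (forall u, u \in us -> u * p = u) /\
    forall v, v * p = q * v * p + \sum_(u <- us) u * (star u * v * p).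
  have [|us [usp usv]] := H 0; first by split; rewrite ?star0 ?mul0r.
  by exists us; split=> // v; rewrite [LHS]usv !mul0r add0r.
have [n] := ubnP (\dim (limg (amull (1 - q)))); elim: n q => // n IH q le pq.
have [h|] := pselect (forall v, (1 - q) * v * p = 0).
  exists [::]; split=> // v; rewrite big_nil addr0; apply/eqP.
  by rewrite -subr_eq0 -mulrBl -[in X in X - _](mul1r v) -mulrBl h.
move=> /existsNP[v /eqP w0].
have [c c0 cE] := min_proj_ge0 ((1 - q) * v) mp.
have {}c0 : 0 < c.
  rewrite lt_neqAle c0 andbT eq_sym; apply: contra w0 => /eqP c00.
  by apply/eqP/star_mul_eq0; rewrite cE c00 scale0r.
pose u := (Num.sqrt c)^-1%:C%C *: ((1 - q) * v * p).
have up : u * p = u by rewrite /u -scalerAl -(mulrA _ p p) pp.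
have uu : star u * u = p.
  rewrite starZr -scalerAl -scalerAr cE !scalerA -!rmorphM /= -invfM -expr2.
  by rewrite sqr_sqrtr ?ltW // mulVf ?gt_eqF // scale1r.
have [sq qq] := pq.
have qu : q * u = 0.
  by rewrite /u -scalerAr !mulrA mulrBr mulr1 qq subrr !mul0r scaler0.
have uq : star u * q = 0 by rewrite -sq -starM qu star0.
have pq' : proj (q + u * star u).
  split; first by rewrite starD starM starK sq.
  rewrite mulrDr !mulrDl qq -!mulrA uq mulr0 addr0 (mulrA q) qu mul0r add0r.
  by rewrite (mulrA (star u)) uu -{1}sp -starM up.
have [|us [usp usv]] := IH _ _ pq'.
  apply: leq_trans (proj_dim_lt (proj1B pq) (proj1B pq') _ _) _ => //.
    rewrite mulrBr mulr1 mulrBl mul1r mulrDl qq -mulrA uq mulr0 addr0.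
    by rewrite subrr subr0.
  rewrite (inj_eq (addrI _)) (inj_eq oppr_inj) -subr_eq0 addrAC subrr add0r.
  apply/eqP => h; move: p0; rewrite -uu -[star u * u](_ : star u * (u * star u) * u = _).
    by rewrite h mulr0 mul0r eqxx.
  by rewrite !mulrA uu -mulrA uu pp.
exists (u :: us); split=> [w|w]; first by rewrite inE => /orP[/eqP ->|/usp].
by rewrite big_cons [LHS]usv mulrDl mulrDl !mulrA addrA.
Qed.

End Resolution.

(** * Positivity of d_R(l) *)

Section IntegralPositivity.
Variables (R : realType) (A : weakHopfType R).
Local Notation K := R[i].

(* With p d p = sum_k (u_k^* S(l_1)^* p)^* (u_k^* l_2 p), d = S(l_1) l_2, each term
   is a value of l at some phi^* phi. *)
Lemma dR_pos_on_min (l : A) : positive_functional l -> pos_on_min (dR l).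
Proof.
move=> lpos p mp; have [[sp pp] p0 _] := mp.
have [us [usp usv]] := min_proj_resolution mp.
(* A coordinate nonzero on p reads c off c p; thus [phi u] sends b to the scalar of [star u * b * p]
   in Cp. *)
have [i ip] : exists i, coord (vbasis {:A}) i p != 0.
  apply: contrapT => h; move: p0; rewrite (coord_vbasis (memvf p)) big1 ?eqxx // => i _.
  apply/eqP; rewrite scaler_eq0; apply/orP; left.
  by apply: contrapT => /negP hi; apply: h; exists i.
pose f u b : K^o := coord (vbasis {:A}) i (star u * b * p) / coord (vbasis {:A}) i p.
have lf u : linear (f u).
  move=> c x y; rewrite /f mulrDr mulrDl -scalerAr -scalerAl linearP mulrDl.
  by rewrite -scalerAl.
pose phi u := linfun (f u).
have phiE u b : u \in us -> star u * b * p = (phi u b : K) *: p.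
  move=> uu; rewrite /phi linfun_lin // /f.
  have [c cE] := min_proj_scal (star u * b) mp.
  have -> : star u * b * p = c *: p.
    by rewrite -cE -{1}(usp _ uu) starM sp !mulrA.
  by rewrite linearZ /= mulfK.
pose z : K := \sum_(u <- us) dual_mul (dual_star (phi u)) (phi u) l.
have z0 : 0 <= z by apply: sumr_ge0 => u _; apply: lpos.
have [c cE] : exists c, z = c%:C%C by apply/complex_realP; rewrite ger0_real.
exists c; first by rewrite -lecR -cE.
rewrite -cE /z big_seq scaler_suml /dR /tlift mulr_sumr mulr_suml.
under [RHS]eq_bigr => u uu do rewrite dual_mulE /tlift scaler_suml.
rewrite exchange_big /=; apply: eq_bigr => j _; rewrite -big_seq.
move: (vbasis _)`_j => b; move: (comul l j : A) => a.
have -> : p * (antipode a * b) * p =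
    \sum_(u <- us) (phi u (lstar a) : K)^* *: (star u * b * p).
  rewrite mulrA -[p * antipode a]starK starM sp -/(lstar a) (usv (lstar a)).
  rewrite (big_morph _ (@starD R A) (star0 A)) !mulr_suml !big_seq.
  apply: eq_bigr => u uu; rewrite phiE // -scalerAr (usp u uu) starZ.
  by rewrite -!scalerAl.
rewrite !big_seq; apply: eq_bigr => u uu.
by rewrite dual_starE phiE // scalerA.
Qed.

End IntegralPositivity.

(** * Counital subalgebras and the antipode *)

Section MoreLinear.
Variables (R : realType) (A : weakHopfType R).
Local Notation K := R[i].

Lemma scaler_lin (X Y : lmodType K) (c : K) (f : X -> Y) :
  linear f -> linear (fun x => c *: f x).
Proof. by move=> lf a x y; rewrite lf scalerDr !scalerA mulrC. Qed.

Lemma epsL_lin (X : lmodType K) (f : X -> A) : linear f -> linear (fun x => epsL (f x)).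
Proof. by move=> lf; rewrite /epsL; apply: tliftt_lin; lin. Qed.

Lemma epsR_lin (X : lmodType K) (f : X -> A) : linear f -> linear (fun x => epsR (f x)).
Proof. by move=> lf; rewrite /epsR; apply: tliftt_lin; lin. Qed.

End MoreLinear.

Ltac wlin := repeat first
  [ assumption
  | lazymatch goal with
    | |- GRing.linear_for _ (fun x => epsL _) => apply: epsL_lin
    | |- GRing.linear_for _ (fun x => epsR _) => apply: epsR_lin
    | |- GRing.linear_for _ (@epsL _ _) => exact: (epsL_lin (@id_lin _ _))
    | |- GRing.linear_for _ (@epsR _ _) => exact: (epsR_lin (@id_lin _ _))
    | |- GRing.linear_for _ (fun x => ?c *: _) => apply: scaler_lin
    | |- GRing.linear_for _ ( *:%R ?c) => exact: (scaler_lin c (@id_lin _ _))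
    | |- GRing.linear_for _ (fun x => ?F _ _) =>
        is_var F; first [ match goal with H : forall b, GRing.linear_for _ (F^~ b) |- _ =>
           apply: (comp_lin (H _)) end
           | match goal with H : forall b, GRing.linear_for _ (F b) |- _ =>
           apply: (comp_lin (H _)) end]
    end
  | lin1 ].

(** * A_R, and comultiplication of products with A_L and A_R *)

Section Basics.
Variables (R : realType) (A : weakHopfType R).
Local Notation K := R[i].
Implicit Types (a b x y z r : A).

Lemma comul_starF (W : lmodType K) (F : A -> A -> W) x :
    (forall b, linear (F^~ b)) -> (forall a, linear (F a)) ->
  \Sw_(z1, z2 <- comul (star x)) F z1 z2 = \Sw_(x1, x2 <- comul x) F (star x1) (star x2).
Proof.
move=> l1 l2; rewrite comul_star (lin_tlift _ _ (tlift_linear l1)).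
by apply: eq_tlift => ? ?; rewrite tlift_ox.
Qed.

(** The functional [e] is again a counit, and a left and a right counit coincide: evaluate ε tensor
    [e] on Δ(x) in both ways. *)
Lemma counit_star x : counit (star x) = (counit x : K)^*.
Proof.
pose e x : K^o := (counit (star x) : K)^*.
have le : linear e.
  by move=> c u v; rewrite /e star_anti linearP rmorphD rmorphM /= conjCK.
suff -> : counit x = e x by rewrite /e conjCK.
transitivity (\Sw_(x1, x2 <- comul x) (counit x1 : K) *: e x2).
  rewrite -[in LHS](starK x) -[star x in LHS]counitr comul_starF; last 2 first.
  - by move=> b; wlin.
  - by move=> a; wlin.
  rewrite (anti_tlift _ _ (@star_anti R A)) (lin_tlift _ _ (lfun_lin _)).
  apply: eq_tlift => x1 x2; rewrite starZ starK linearZ /= /e.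
  exact: mulrC.
rewrite -[in RHS](counitl x) (lin_tlift _ _ le); apply: eq_tlift => x1 x2.
by rewrite (linZ le).
Qed.

Lemma counit_mulr x z : counit (x * z) =
  \Sw_(u1, u2 <- comul 1) ((counit (x * u1) : K) * counit (u2 * z)).
Proof. by rewrite -[in LHS](mulr1 x) counitM. Qed.

(** The axiom pairs the legs of Δ(1) in one order; the involution yields the opposite order. *)
Lemma counit_mull x z : counit (x * z) =
  \Sw_(u1, u2 <- comul 1) ((counit (x * u2) : K) * counit (u1 * z)).
Proof.
have l1 (b : A) : linear (fun a : A => (counit (x * b) : K) *: (counit (a * z) : K^o)) by wlin.
have l2 (a : A) : linear (fun b : A => (counit (x * b) : K) *: (counit (a * z) : K^o)) by wlin.
rewrite -[LHS]conjCK -counit_star starM counit_mulr /tlift rmorph_sum /=.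
rewrite -[RHS](comul1_star l1 l2); apply: eq_bigr => i _.
by rewrite rmorphM /= -!counit_star !starM !starK mulrC.
Qed.

(** The counital maps with the product inside ε reversed: the conjugates of [epsR] and [epsL] by the
    involution ([epsR_star], [epsL_star]). *)
Definition epsRb a : A := \Sw_(u1, u2 <- comul 1) counit (u2 * a) *: u1.
Definition epsLb a : A := \Sw_(u1, u2 <- comul 1) counit (a * u1) *: u2.

(** A_R is encoded through Δ, which makes closure under products and adjoints easy. Applying ε to
    the second leg recovers r as a first leg of Δ(1). *)
Definition in_AR r : Prop :=
  comul r = \Sw_(u1, u2 <- comul 1) u1 \ox (u2 * r) /\
  comul r = \Sw_(u1, u2 <- comul 1) u1 \ox (r * u2).

Lemma comul_ARl (W : lmodType K) (F : A -> A -> W) r : in_AR r ->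
    (forall b, linear (F^~ b)) -> (forall a, linear (F a)) ->
  \Sw_(b1, b2 <- comul r) F b1 b2 = \Sw_(u1, u2 <- comul 1) F u1 (u2 * r).
Proof.
move=> [-> _] l1 l2; rewrite (lin_tlift _ _ (tlift_linear l1)).
by apply: eq_tlift => ? ?; rewrite tlift_ox.
Qed.

Lemma comul_ARr (W : lmodType K) (F : A -> A -> W) r : in_AR r ->
    (forall b, linear (F^~ b)) -> (forall a, linear (F a)) ->
  \Sw_(b1, b2 <- comul r) F b1 b2 = \Sw_(u1, u2 <- comul 1) F u1 (r * u2).
Proof.
move=> [_ ->] l1 l2; rewrite (lin_tlift _ _ (tlift_linear l1)).
by apply: eq_tlift => ? ?; rewrite tlift_ox.
Qed.

(** By coassociativity Δ of this element is a contraction of the threefold coproduct of 1, which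
    factors through two copies of Δ(1) multiplied in either order; each order gives one half. *)
Lemma in_AR_leg (phi : A -> K^o) : linear phi ->
  in_AR (\Sw_(u1, u2 <- comul 1) (phi u2 : K) *: u1).
Proof.
move=> lphi; pose G (a b c : A) := (phi c : K) *: (a \ox b).
have G1 y z : linear (fun x => G x y z) by rewrite /G; wlin.
have G2 x z : linear (fun y => G x y z) by rewrite /G; wlin.
have G3 x y : linear (G x y) by rewrite /G; wlin; exact: (scalel_lin _ lphi).
have E : comul (\Sw_(u1, u2 <- comul 1) (phi u2 : K) *: u1) =
    \Sw_(x1, y <- comul (1 : A)) \Sw_(x2, x3 <- comul y) G x1 x2 x3.
  rewrite comul_assoc // (lin_tlift _ _ (lfun_lin _)); apply: eq_tlift => y x3.
  by rewrite linearZ /= [comul y in LHS]tensE /tlift scaler_sumr.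
split; rewrite E.
- rewrite -comul1_mid //; apply: eq_tlift => a1 a2.
  have l : linear (fun z : A => a1 \ox (a2 * z)) by wlin.
  by rewrite (lin_tlift _ _ l); apply: eq_tlift => b1 b2; rewrite (linZ l).
rewrite -comul1_midC //; apply: eq_tlift => a1 a2.
have l : linear (fun z : A => a1 \ox (z * a2)) by wlin.
by rewrite (lin_tlift _ _ l); apply: eq_tlift => b1 b2; rewrite (linZ l).
Qed.

(** Apply the functional defining y to the first leg of the two expressions for Δ(r). *)
Lemma AL_AR_comm y r : in_AL y -> in_AR r -> y * r = r * y.
Proof.
move=> [phi ->] [E1 E2].
have l1 (b : A) : linear (fun a : A => (phi a : K) *: b) by wlin.
have := congr1 (tlift (fun a b : A => (phi a : K) *: b)) (etrans (esym E1) E2).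
rewrite !(lin_tlift _ _ (tlift_linear l1)) => E.
rewrite (lin_tlift _ _ (mulr_lin _ (@id_lin _ A))) (lin_tlift _ _ (mull_lin _ (@id_lin _ A))).
transitivity (\Sw_(u1, u2 <- comul (1 : A)) (phi u1 : K) *: (u2 * r)).
  by apply: eq_tlift => a b; rewrite scalerAl.
transitivity (\Sw_(u1, u2 <- comul (1 : A)) (phi u1 : K) *: (r * u2)).
  rewrite -[LHS](eq_tlift
    (f := fun u v => tlift (fun a b : A => (phi a : K) *: b) (u \ox (v * r)))).
    by rewrite E; apply: eq_tlift => a b; rewrite tlift_ox //; wlin.
  by move=> a b; rewrite tlift_ox //; wlin.
by apply: eq_tlift => a b; rewrite scalerAr.
Qed.

Lemma comul_mulAR (W : lmodType K) (F : A -> A -> W) a r : in_AR r ->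
    (forall b, linear (F^~ b)) -> (forall a, linear (F a)) ->
  \Sw_(z1, z2 <- comul (a * r)) F z1 z2 = \Sw_(a1, a2 <- comul a) F a1 (a2 * r).
Proof.
move=> rR l1 l2; rewrite comul_mul // -[in RHS](mulr1 a).
rewrite (comul_mul (F := fun x y => F x (y * r))); [|wlin|wlin].
apply: eq_tlift => a1 a2; rewrite (comul_ARl rR); [|wlin|wlin].
by apply: eq_tlift => u1 u2; rewrite mulrA.
Qed.

Lemma comul_ARmul (W : lmodType K) (F : A -> A -> W) a r : in_AR r ->
    (forall b, linear (F^~ b)) -> (forall a, linear (F a)) ->
  \Sw_(z1, z2 <- comul (r * a)) F z1 z2 = \Sw_(a1, a2 <- comul a) F a1 (r * a2).
Proof.
move=> rR l1 l2; rewrite comul_mul // -[in RHS](mul1r a).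
rewrite (comul_mul (F := fun x y => F x (r * y))); [|wlin|wlin].
rewrite (comul_ARr rR); [|wlin|wlin].
by do 2!apply: eq_tlift => ? ?; rewrite mulrA.
Qed.

Lemma comul_mulAL (W : lmodType K) (F : A -> A -> W) a y : in_AL y ->
    (forall b, linear (F^~ b)) -> (forall a, linear (F a)) ->
  \Sw_(z1, z2 <- comul (a * y)) F z1 z2 = \Sw_(a1, a2 <- comul a) F (a1 * y) a2.
Proof.
move=> yL l1 l2; rewrite comul_mul // -[in RHS](mulr1 a).
rewrite (comul_mul (F := fun x z => F (x * y) z)); [|wlin|wlin].
apply: eq_tlift => a1 a2; rewrite (comul_ALr yL); [|wlin|wlin].
by apply: eq_tlift => u1 u2; rewrite mulrA.
Qed.

Lemma comul_ALmul (W : lmodType K) (F : A -> A -> W) a y : in_AL y ->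
    (forall b, linear (F^~ b)) -> (forall a, linear (F a)) ->
  \Sw_(z1, z2 <- comul (y * a)) F z1 z2 = \Sw_(a1, a2 <- comul a) F (y * a1) a2.
Proof.
move=> yL l1 l2; rewrite comul_mul // -[in RHS](mul1r a).
rewrite (comul_mul (F := fun x z => F (y * x) z)); [|wlin|wlin].
rewrite (comul_ALl yL); [|wlin|wlin].
by do 2!apply: eq_tlift => ? ?; rewrite mulrA.
Qed.

End Basics.

(** * Counital maps and closure properties of A_R *)

Section Counital.
Variables (R : realType) (A : weakHopfType R).
Local Notation K := R[i].
Implicit Types (a b x y z r : A).

Lemma epsLE a : epsL a = \Sw_(u1, u2 <- comul 1) counit (u1 * a) *: u2.
Proof. exact: antipoder. Qed.
Lemma epsRE a : epsR a = \Sw_(u1, u2 <- comul 1) counit (a * u2) *: u1.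
Proof. exact: antipodel. Qed.
Lemma epsL_linear : linear (@epsL R A).
Proof. exact: epsL_lin (@id_lin _ A). Qed.
Lemma epsR_linear : linear (@epsR R A).
Proof. exact: epsR_lin (@id_lin _ A). Qed.

Lemma epsR_AR a : in_AR (epsR a).
Proof. by rewrite epsRE; apply: in_AR_leg; wlin. Qed.

Lemma epsRb_AR a : in_AR (epsRb a).
Proof. by apply: (in_AR_leg (phi := fun u => counit (u * a))); wlin. Qed.

Lemma epsLb_AL a : in_AL (epsLb a).
Proof.
exists (linfun (fun u : A => counit (a * u) : K^o)); rewrite /epsLb.
apply: eq_tlift => u v; rewrite (linfun_lin (f := fun u : A => counit (a * u) : K^o)) //.
by wlin.
Qed.

Lemma epsR1 : epsR (1 : A) = 1.
Proof.
rewrite epsRE -[RHS]counitr; apply: eq_tlift => u v.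
by rewrite mul1r.
Qed.

Lemma epsL1 : epsL (1 : A) = 1.
Proof.
rewrite epsLE -[RHS]counitl; apply: eq_tlift => u v.
by rewrite mulr1.
Qed.

Lemma epsR_mulAR a r : in_AR r -> epsR (a * r) = epsR a * r.
Proof.
move=> rR; rewrite /epsR (comul_mulAR (F := fun x y => antipode x * y)) //; [|wlin|wlin].
rewrite (lin_tlift _ _ (mulr_lin _ (@id_lin _ A))).
by apply: eq_tlift => u v; rewrite mulrA.
Qed.

Lemma epsL_ALmul a y : in_AL y -> epsL (y * a) = y * epsL a.
Proof.
move=> yL; rewrite /epsL (comul_ALmul (F := fun x y => x * antipode y)) //; [|wlin|wlin].
rewrite (lin_tlift _ _ (mull_lin _ (@id_lin _ A))).
by apply: eq_tlift => u v; rewrite mulrA.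
Qed.

Lemma in_AR1 : in_AR (1 : A).
Proof. by rewrite -epsR1; apply: epsR_AR. Qed.

(** Split ε(v_1 a) as ε(v_1 u_1) ε(u_2 a). Every value of [epsL] is thus attained on A_R, where Δ is
    explicit. *)
Lemma epsL_epsRb a : epsL (epsRb a) = epsL a.
Proof.
rewrite /epsRb (lin_tlift _ _ epsL_linear) epsLE.
under [RHS]eq_tlift => v1 v2 do rewrite counit_mulr /tlift scaler_suml.
rewrite [RHS]exchange_big /=; apply: eq_bigr => i _.
rewrite (linZ epsL_linear) epsLE /tlift scaler_sumr.
by apply: eq_bigr => j _; rewrite scalerA mulrC.
Qed.

Lemma epsR_epsLb a : epsR (epsLb a) = epsR a.
Proof.
rewrite /epsLb (lin_tlift _ _ epsR_linear) epsRE.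
under [RHS]eq_tlift => v1 v2 do rewrite counit_mulr /tlift scaler_suml.
rewrite [RHS]exchange_big /=; apply: eq_bigr => i _.
rewrite (linZ epsR_linear) epsRE /tlift scaler_sumr.
by apply: eq_bigr => j _; rewrite scalerA.
Qed.

Lemma mul_epsR (x : A) : \Sw_(x1, x2 <- comul x) (x1 * epsR x2) = x.
Proof.
rewrite -[RHS](counitr x) -[in RHS](mulr1 x) comul_mul; [|wlin|wlin].
apply: eq_tlift => x1 x2; rewrite epsRE.
rewrite (lin_tlift _ _ (mull_lin _ (@id_lin _ A))).
by apply: eq_tlift => u v; rewrite scalerAr.
Qed.

Lemma AR_lin c r s : in_AR r -> in_AR s -> in_AR (c *: r + s).
Proof.
move=> [r1 r2] [s1 s2]; split; rewrite linearP /=.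
  rewrite r1 s1; symmetry; apply: (tlift_param (f := fun z u v => u \ox (v * z))).
  by move=> u v; wlin.
rewrite r2 s2; symmetry; apply: (tlift_param (f := fun z u v => u \ox (z * v))).
by move=> u v; wlin.
Qed.

Lemma AR_mul r s : in_AR r -> in_AR s -> in_AR (r * s).
Proof.
move=> rR sR; split; rewrite [LHS]tensE.
  rewrite (comul_mulAR _ sR) ?(comul_ARl rR); [|wlin..].
  by apply: eq_tlift => u v; rewrite mulrA.
rewrite (comul_ARmul _ rR) ?(comul_ARr sR); [|wlin..].
by apply: eq_tlift => u v; rewrite mulrA.
Qed.

Lemma AR_star r : in_AR r -> in_AR (star r).
Proof.
pose G := tlift (fun a b : A => star a \ox star b).
have an1 b : antilin (fun a : A => star a \ox star b).
  by move=> c x y; rewrite star_anti (linD (ox_linl _)) (linZ (ox_linl _)).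
have an2 a : antilin (fun b : A => star a \ox star b).
  by move=> c x y; rewrite star_anti (linD (ox_linr _)) (linZ (ox_linr _)).
have anG : antilin G by apply: tlift_anti.
move=> [E1 E2]; split; rewrite comul_star -/(G _).
  rewrite E2 (anti_tlift _ _ anG) -(comul1_star (F := fun u v => u \ox (v * star r))); [|wlin|wlin].
  by apply: eq_tlift => u v; rewrite /G tlift_ox_anti // starM.
rewrite E1 (anti_tlift _ _ anG).
rewrite -(comul1_star (F := fun u v => u \ox (star r * v))); [|wlin|wlin].
by apply: eq_tlift => u v; rewrite /G tlift_ox_anti // starM.
Qed.

Lemma AR_pev r f : in_AR r -> in_AR (pev r f).
Proof.
move=> rR; apply: pev_ind; first exact: in_AR1.
  by move=> c x y; apply: AR_lin.
by move=> x xR; apply: AR_mul.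
Qed.

End Counital.

(** * Antimultiplicativity and inverse of the antipode *)

Section Antipode.
Variables (R : realType) (A : weakHopfType R).
Local Notation K := R[i].
Local Notation S := (@antipode R A).
Implicit Types (a b x y z r : A).

Lemma counit_epsR x z : counit (epsR x * z) = counit (x * z).
Proof.
have l : linear (fun a : A => counit (a * z) : K^o) by wlin.
rewrite epsRE (lin_tlift _ _ l) counit_mull; apply: eq_tlift => u v.
by rewrite (linZ l).
Qed.

Lemma counit_epsL x z : counit (x * epsL z) = counit (x * z).
Proof.
have l : linear (fun a : A => counit (x * a) : K^o) by wlin.
rewrite epsLE (lin_tlift _ _ l) counit_mull; apply: eq_tlift => u v.
by rewrite (linZ l) mulrC.
Qed.

Lemma antipode_epsL z : \Sw_(z1, z2 <- comul z) (S z1 * epsL z2) = S z.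
Proof.
rewrite -[RHS]antipode_mid; apply: eq_tlift => x1 y.
rewrite /epsL (lin_tlift _ _ (mull_lin _ (@id_lin _ A))).
by apply: eq_tlift => u v; rewrite mulrA.
Qed.

Lemma antipode_epsR z : \Sw_(z1, z2 <- comul z) (epsR z1 * S z2) = S z.
Proof.
rewrite -[RHS]antipode_mid.
rewrite (comul_assoc (F := fun a b c => S a * b * S c)); [|wlin|wlin|wlin].
apply: eq_tlift => y x3.
by rewrite /epsR (lin_tlift _ _ (mulr_lin _ (@id_lin _ A))).
Qed.

(** Replacing y by [epsL y] does not change the left side, and an element of A_L on the right of x
    multiplies only the first leg of Δ(x). *)
Lemma epsLM x y : epsL (x * y) = \Sw_(x1, x2 <- comul x) (x1 * epsL y * S x2).
Proof.
transitivity (epsL (x * epsL y)).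
  rewrite (epsLE (x * y)) (epsLE (x * _)); apply: eq_tlift => u v.
  by rewrite !mulrA counit_epsL.
rewrite {1}/epsL (comul_mulAL (F := fun a b => a * S b) _ (epsL_AL y)) //; wlin.
Qed.

Lemma epsRM x y : epsR (x * y) = \Sw_(y1, y2 <- comul y) (S y1 * (epsR x * y2)).
Proof.
transitivity (epsR (epsR x * y)).
  rewrite (epsRE (x * y)) (epsRE (_ * y)); apply: eq_tlift => u v.
  by rewrite -!mulrA counit_epsR.
rewrite {1}/epsR (comul_ARmul (F := fun a b => S a * b) _ (epsR_AR x)) //; wlin.
Qed.

(** S(xy) expands to S(x_1 y_1) x_2 y_2 S(y_3) S(x_3). Regrouping gives S(y_1) ε_R(x_1) ε_L(y_2)
    S(x_2), and the two middle factors commute. *)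
Lemma antipodeM x y : S (x * y) = S y * S x.
Proof.
rewrite -antipode_epsL (comul_mul (F := fun a b => S a * epsL b)); [|wlin|wlin].
transitivity (\Sw_(x1, x' <- comul x) \Sw_(x2, x3 <- comul x')
    \Sw_(y1, y' <- comul y) \Sw_(y2, y3 <- comul y')
    (S (x1 * y1) * (x2 * y2) * (S y3 * S x3))).
  apply: eq_tlift => x1 x'; rewrite tlift_exch; apply: eq_tlift => y1 y'.
  rewrite epsLM (lin_tlift _ _ (mull_lin _ (@id_lin _ A))).
  apply: eq_tlift => x2 x3; rewrite [epsL y']/epsL.
  have l : linear (fun z => S (x1 * y1) * (x2 * z * S x3)) by wlin.
  by rewrite (lin_tlift _ _ l); apply: eq_tlift => y2 y3; rewrite !mulrA.
rewrite comul_assoc; [|wlin|wlin|wlin].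
transitivity (\Sw_(x', x3 <- comul x) \Sw_(y', y3 <- comul y)
    (epsR (x' * y') * (S y3 * S x3))).
  apply: eq_tlift => x' x3.
  under eq_tlift => x1 x2 do [rewrite comul_assoc; [|wlin|wlin|wlin]].
  rewrite tlift_exch; apply: eq_tlift => y' y3.
  have l : linear (fun z => z * (S y3 * S x3)) by wlin.
  rewrite {1}/epsR (comul_mul (F := fun a b => S a * b)); [|wlin|wlin].
  rewrite (lin_tlift _ _ l); apply: eq_tlift => x1 x2.
  by rewrite (lin_tlift _ _ l).
transitivity (\Sw_(x', x3 <- comul x) \Sw_(y1, y' <- comul y)
    (S y1 * epsR x' * epsL y' * S x3)).
  apply: eq_tlift => x' x3.
  transitivity (\Sw_(y', y3 <- comul y) \Sw_(y1, y2 <- comul y')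
     (S y1 * (epsR x' * y2) * (S y3 * S x3))).
    apply: eq_tlift => y' y3; rewrite epsRM.
    by rewrite (lin_tlift _ _ (mulr_lin _ (@id_lin _ A))).
  rewrite -(comul_assoc (F := fun a b c => S a * (epsR x' * b) * (S c * S x3))); [|wlin|wlin|wlin].
  apply: eq_tlift => y1 y'; rewrite /epsL.
  have l : linear (fun z => S y1 * epsR x' * z * S x3) by wlin.
  by rewrite (lin_tlift _ _ l); apply: eq_tlift => y2 y3; rewrite !mulrA.
rewrite -[S y]antipode_epsL -[S x]antipode_epsR tlift_exch.
rewrite (lin_tlift _ _ (mulr_lin _ (@id_lin _ A))); apply: eq_tlift => y1 y'.
rewrite (lin_tlift _ _ (mull_lin _ (@id_lin _ A))); apply: eq_tlift => x' x3.
by rewrite -!mulrA (mulrA (epsL y')) (AL_AR_comm (epsL_AL y') (epsR_AR x')) !mulrA.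
Qed.

Lemma AL_star y : in_AL y -> in_AL (star y).
Proof.
move=> [phi ->]; pose f (a : A) : K^o := (phi (star a) : K)^*.
have lf : linear f.
  by move=> c u v; rewrite /f star_anti linearP rmorphD rmorphM /= conjCK.
exists (linfun f); rewrite (anti_tlift _ _ (@star_anti R A)).
under [RHS]eq_tlift => u v do rewrite (linfun_lin lf).
rewrite -[RHS]comul1_star; [|by move=> b; exact: (scalel_lin _ lf)|wlin].
by apply: eq_tlift => u v; rewrite starZ /f starK.
Qed.

Lemma epsL_star x : star (epsL (star x)) = epsLb x.
Proof.
rewrite epsLE (anti_tlift _ _ (@star_anti R A)) /epsLb -[RHS]comul1_star; [|wlin|wlin].
by apply: eq_tlift => u v; rewrite starZ -counit_star starM starK.
Qed.

Lemma epsR_star x : star (epsR (star x)) = epsRb x.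
Proof.
rewrite epsRE (anti_tlift _ _ (@star_anti R A)) /epsRb -[RHS]comul1_star; [|wlin|wlin].
by apply: eq_tlift => u v; rewrite starZ -counit_star starM starK.
Qed.

(** Multiply S(r) on the left by 1 = 1_(1) S(1_(2)) and use Δ(r) = 1_(1) tensor r 1_(2). *)
Lemma antipode_AR r : in_AR r -> S r = epsL r.
Proof.
move=> rR; rewrite /epsL (comul_ARr (F := fun a b => a * S b) rR); [|wlin|wlin].
rewrite -[LHS]mul1r -{1}epsL1 /epsL (lin_tlift _ _ (mulr_lin _ (@id_lin _ A))).
by apply: eq_tlift => u v; rewrite antipodeM mulrA.
Qed.

Lemma antipode_AL y : in_AL y -> S y = epsR y.
Proof.
move=> yL; rewrite /epsR (comul_ALr (F := fun a b => S a * b) yL); [|wlin|wlin].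
rewrite -[LHS]mulr1 -{1}epsR1 /epsR (lin_tlift _ _ (mull_lin _ (@id_lin _ A))).
by apply: eq_tlift => u v; rewrite antipodeM mulrA.
Qed.

(** This turns out to be the inverse of S; see [antipode_inv]. *)
Definition cantipode x : A := star (S (star x)).
Local Notation T := cantipode.

Lemma cantipode_lin : linear T.
Proof. by move=> c x y; rewrite /T star_anti linearP star_anti conjCK. Qed.

Lemma cantipodeM x y : T (x * y) = T y * T x.
Proof. by rewrite /T starM antipodeM starM. Qed.

Lemma cantipode_AR r : in_AR r -> T r = epsLb r.
Proof. by move=> rR; rewrite /T antipode_AR ?epsL_star //; apply: AR_star. Qed.

Lemma cantipode_AL y : in_AL y -> T y = epsRb y.
Proof. by move=> yL; rewrite /T antipode_AL ?epsR_star //; apply: AL_star. Qed.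

Lemma mul_cantipode y : \Sw_(y1, y2 <- comul y) (y2 * T y1) = epsRb y.
Proof.
rewrite -epsR_star /epsR (comul_starF (F := fun a b => S a * b)); [|wlin|wlin].
rewrite (anti_tlift _ _ (@star_anti R A)).
by apply: eq_tlift => u v; rewrite starM starK.
Qed.

(* Both sides evaluate x_3 T(x_2) T(S x_1), grouped in the two possible ways. *)
Lemma cantipodeK : cancel S T.
Proof.
move=> x; have lTS (X : lmodType K) (f : X -> A) : linear f -> linear (fun w => T (f w)).
  exact: comp_lin cantipode_lin.
transitivity (\Sw_(x1, y <- comul x) (epsRb y * T (S x1))).
  rewrite -{1}[S x]antipode_epsL (lin_tlift _ _ cantipode_lin).
  apply: eq_tlift => x1 y; rewrite cantipodeM; congr (_ * _).
  rewrite cantipode_AL; last exact: epsL_AL.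
  by apply: eq_tlift => u v; rewrite counit_epsL.
transitivity (\Sw_(x1, y <- comul x) \Sw_(x2, x3 <- comul y) (x3 * (T x2 * T (S x1)))).
  apply: eq_tlift => x1 y; rewrite -mul_cantipode.
  rewrite (lin_tlift _ _ (mulr_lin _ (@id_lin _ A))).
  by apply: eq_tlift => u v; rewrite mulrA.
rewrite comul_assoc.
- transitivity (\Sw_(y, x3 <- comul x) (x3 * epsLb y)).
    apply: eq_tlift => y x3; rewrite -(_ : T (epsR y) = epsLb y).
      rewrite {1}/epsR (lin_tlift _ _ cantipode_lin).
      rewrite (lin_tlift _ _ (mull_lin _ (@id_lin _ A))).
      by apply: eq_tlift => u v; rewrite cantipodeM.
    rewrite cantipode_AR; last exact: epsR_AR.
    by apply: eq_tlift => u v; rewrite counit_epsR.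
  rewrite -[RHS]counitl -[in RHS](mulr1 x) comul_mul; [|wlin|wlin].
  apply: eq_tlift => y x3; rewrite /epsLb.
  rewrite (lin_tlift _ _ (mull_lin _ (@id_lin _ A))).
  by apply: eq_tlift => u v; rewrite scalerAr.
- by move=> b c; do 2!apply: mull_lin; apply: lTS; lin.
- by move=> a c; apply: mull_lin; apply: mulr_lin; apply: lTS; lin.
by wlin.
Qed.

(** A left inverse makes S injective, hence bijective in finite dimension. *)
Lemma antipode_inv x : (S^-1)%VF x = T x.
Proof.
have S0 : lker S == 0%VS by apply/lker0P; apply: can_inj cantipodeK.
by rewrite -[RHS](congr1 T (lker0_lfunVK S0 x)) cantipodeK.
Qed.

Lemma nRE (l : A) : nR l = epsRb l.
Proof.
by rewrite -mul_cantipode; apply: eq_tlift => u v; rewrite antipode_inv.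
Qed.

End Antipode.

(** * The Haar integral *)

Section Haar.
Variables (R : realType) (A : weakHopfType R) (h : A).
Hypothesis haar_h : haar_integral h.
Local Notation K := R[i].
Implicit Types (a b x y z r s : A).

Lemma haarl a : a * h = epsL a * h. Proof. by case: haar_h => H _ _ _; apply: H. Qed.
Lemma haarr a : h * a = h * epsR a. Proof. by case: haar_h => _ H _ _; apply: H. Qed.
Lemma haar_epsR : epsR h = 1. Proof. by case: haar_h. Qed.
Lemma haar_epsL : epsL h = 1. Proof. by case: haar_h. Qed.

Lemma haar_idem : h * h = h.
Proof. by rewrite haarl haar_epsL mul1r. Qed.

(** From ε_R(h) = 1 follows ε_L(star h) = 1, so h equals [star h * h], which is self-adjoint. *)
Lemma haar_star : star h = h.
Proof.
have E : epsL (star h) = 1.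
  rewrite -[epsL _]starK epsL_star -[RHS](star1 A) -[in RHS]epsL1 epsLE; congr star.
  by apply: eq_tlift => u v; rewrite -counit_epsR haar_epsR mul1r mulr1.
have E2 : star h * h = h by rewrite haarl E mul1r.
by rewrite -[in RHS]E2 -[in LHS]E2 starM starK.
Qed.

(** [epsR] recovers r from h r, since ε_R(h r) = ε_R(h) r = r. *)
Lemma haar_AR_inj r : in_AR r -> h * r = 0 -> r = 0.
Proof.
by move=> rR hr; rewrite -[r]mul1r -haar_epsR -epsR_mulAR // hr (lin0 (@epsR_linear _ A)).
Qed.

Lemma haar_AR_injl r : in_AR r -> r * h = 0 -> r = 0.
Proof.
move=> rR /(congr1 (@star R A)); rewrite starM haar_star star0.
by move=> /(haar_AR_inj (AR_star rR)) /(congr1 (@star R A)); rewrite starK star0.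
Qed.

Lemma left_integral_haar l : left_integral l -> h * l = l.
Proof. by move=> ->; rewrite haar_epsL mul1r. Qed.

Lemma left_integralE l : left_integral l -> l = h * dR l.
Proof. by move=> lI; rewrite -{1}(left_integral_haar lI) haarr. Qed.

(** The element w of A_R with h r h = h w; it acts as a conditional expectation with central
    values. *)
Definition haar_exp r := epsR (r * h).

Lemma haar_exp_AR r : in_AR (haar_exp r). Proof. exact: epsR_AR. Qed.

Lemma haar_expE r : h * r * h = h * haar_exp r.
Proof. by rewrite -mulrA haarr. Qed.

Lemma haar_exp_lin : linear haar_exp.
Proof. by rewrite /haar_exp; wlin. Qed.

Lemma AR_eq r s : in_AR r -> in_AR s -> h * r = h * s -> r = s.
Proof.
move=> rR sR /eqP; rewrite -subr_eq0 -mulrBr => /eqP E; apply/eqP.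
rewrite -subr_eq0; apply/eqP/haar_AR_inj => //.
by rewrite addrC -scaleN1r; apply: AR_lin.
Qed.

(* h r h is both z h and h w with z in A_L, w in A_R; comparing (z h) a with
   h (w a) gives epsR (w a) = w epsR a, whose instances a in A_L say that w
   commutes with A_R. *)
Lemma haar_exp_central r a : haar_exp r * a = a * haar_exp r.
Proof.
set w := haar_exp r; have wR : in_AR w := haar_exp_AR r.
pose z := epsL (h * r); have zw : z * h = h * w by rewrite -haarl haar_expE.
have epsRw b : epsR (w * b) = w * epsR b.
  apply: AR_eq; [exact: epsR_AR|by apply: AR_mul => //; exact: epsR_AR|].
  by rewrite -haarr !mulrA -zw -!mulrA -haarr.
have wc b : w * epsR b = epsR b * w.
  rewrite -(epsR_epsLb b) -epsRw -(AL_AR_comm (epsLb_AL b) wR).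
  by rewrite epsR_mulAR.
rewrite -[LHS]mul_epsR (comul_ARmul (F := fun a b => a * epsR b) _ wR); [|wlin|wlin].
rewrite -[a in RHS]mul_epsR (lin_tlift _ _ (mulr_lin _ (@id_lin _ A))).
by apply: eq_tlift => a1 a2; rewrite epsRw wc mulrA.
Qed.

Lemma haar_exp_star r : star (haar_exp r) = haar_exp (star r).
Proof.
apply: AR_eq; [exact: AR_star (haar_exp_AR r)|exact: haar_exp_AR|].
rewrite -haar_expE -[X in X * star _]haar_star -starM haar_exp_central -haar_expE.
by rewrite !starM haar_star mulrA.
Qed.

Lemma haar_expM c r : in_AR c -> (forall a, c * a = a * c) ->
  haar_exp (c * r) = c * haar_exp r.
Proof.
move=> cR cC; apply: AR_eq; [exact: haar_exp_AR|by apply: AR_mul => //; exact: haar_exp_AR|].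
by rewrite -haar_expE mulrA -cC -!mulrA (mulrA h r) haar_expE !mulrA cC.
Qed.

(** Faithfulness of the expectation: h y y h = h E(y y) = 0 forces y h = 0. *)
Lemma haar_exp_sqr_eq0 y : in_AR y -> star y = y -> haar_exp (y * y) = 0 -> y = 0.
Proof.
move=> yR sy y0; apply: haar_AR_injl => //; apply: star_mul_eq0.
by rewrite starM haar_star sy mulrA -(mulrA h) haar_expE y0 mulr0.
Qed.

End Haar.

(** * Injectivity of x |-> x h x, normalization and nondegeneracy *)

Section JonesElement.
Variables (R : realType) (A : weakHopfType R) (h : A).
Hypothesis haar_h : haar_integral h.
Local Notation K := R[i].
Local Notation E := (haar_exp h).
Implicit Types (a b c x y z r s l : A).

Lemma AR_D r s : in_AR r -> in_AR s -> in_AR (r + s).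
Proof. by move=> rR sR; rewrite -[r]scale1r; apply: AR_lin. Qed.
Lemma AR_N r : in_AR r -> in_AR (- r).
Proof.
move=> rR; have := AR_lin (-1) rR (AR_lin (-1) rR rR).
by rewrite !scaleN1r addNr addr0.
Qed.

Lemma haar_expN r : E (- r) = - E r.
Proof. by rewrite -scaleN1r (linZ (@haar_exp_lin _ _ _)) scaleN1r. Qed.
Lemma haar_exp0 : E 0 = 0.
Proof. exact: lin0 (@haar_exp_lin _ _ _). Qed.

(* With s = x + x' and y = x - x', the hypothesis reads s h y + y h s = 0, and the
   central elements E(ss), E(sy), E(yy) are shown to annihilate enough to force
   E(yy) = 0; positivity of x and x' enters through E(yy) s = 0. *)
Lemma jones_inj x x' : in_AR x -> in_AR x' -> cpos x -> cpos x' ->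
  x * h * x = x' * h * x' -> x = x'.
Proof.
move=> xR xR' px px' ee; have sx := cpos_star px; have sx' := cpos_star px'.
pose s := x + x'; pose y := x - x'.
have sR : in_AR s by apply: AR_D.
have yR : in_AR y by apply: AR_D => //; apply: AR_N.
have ss : star s = s by rewrite starD sx sx'.
have sy : star y = y by rewrite starB sx sx'.
have shy : s * h * y = - (y * h * s).
  rewrite /s /y !(mulrDl, mulrDr, mulNr, mulrN) ee !opprD !opprK.
  move: (x' * h * x') (x' * h * x) (x * h * x') => P Q T.
  by rewrite [P + Q]addrC [- T - P]addrC addrA addrK [- P + Q]addrC [- T + P]addrC addrA subrK.
have EC r := haar_exp_central haar_h r; have ER r : in_AR (E r) := haar_exp_AR _ r.
have mv r t t' : h * r * (t * h * t') = h * (E (r * t) * t').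
  by rewrite [in RHS]mulrA -(haar_expE haar_h) !mulrA.
have ARn r t : in_AR r -> in_AR t -> in_AR (- (r * t)) by move=> ? ?; apply/AR_N/AR_mul.
have e1 : E (s * s) * y = - (E (s * y) * s).
  by apply: (AR_eq haar_h); [exact: AR_mul|exact: ARn|rewrite -mv shy mulrN mv mulrN].
have e2 : E (y * s) * y = - (E (y * y) * s).
  by apply: (AR_eq haar_h); [exact: AR_mul|exact: ARn|rewrite -mv shy mulrN mv mulrN].
have EM r t c : E (t * (E r * c)) = E r * E (t * c).
  by rewrite mulrA -EC -mulrA (haar_expM haar_h).
(* Applying E(s .) to [e1] gives 2 E(ss) E(sy) = 0 by centrality; applied to [e2] it gives E(ys)
   E(sy) = - E(yy) E(ss). *)
have E1 := congr1 (fun t => E (s * t)) e1; have E2 := congr1 (fun t => E (s * t)) e2.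
have Es r : star (E r) = E (star r) := haar_exp_star haar_h r.
move: E1 E2; rewrite !mulrN !haar_expN !EM.
have sa : star (E (s * s)) = E (s * s) by rewrite Es starM ss.
have sg : star (E (y * y)) = E (y * y) by rewrite Es starM sy.
have sb : star (E (s * y)) = E (y * s) by rewrite Es starM ss sy.
rewrite -(EC (s * y)) => ab.
have {}ab : E (s * s) * E (s * y) = 0.
  have : 2%:R *: (E (s * y) * E (s * s)) = 0 :> A.
    by rewrite scaler_nat mulr2n {1}ab addNr.
  by move/eqP; rewrite scaler_eq0 pnatr_eq0 /= EC => /eqP.
have ay : E (s * s) * y = 0.
  apply: star_mul_eq0; rewrite starM sy sa -mulrA e1 mulrN mulrA ab mul0r oppr0.
  by rewrite mulr0.
have ag : E (y * y) * E (s * s) = 0 by rewrite EC -EM ay mulr0 haar_exp0.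
rewrite ag oppr0 -sb => /star_mul_eq0 b0.
have gs : E (y * y) * s = 0.
  by apply/eqP; rewrite -oppr_eq0 -e2 -sb b0 star0 mul0r.
case: px px' => [u xE] [v xE'].
(* For g = E(yy), the product g s g = 0 is the sum of the positive elements g x g and g x' g; hence
   x g = x' g = 0. *)
have key w z t : star w * w = z -> star t * t = s - z -> z * E (y * y) = 0.
  move=> wz tz; have : star (w * E (y * y)) * (w * E (y * y)) +
      star (t * E (y * y)) * (t * E (y * y)) = 0.
    rewrite !starM sg -!mulrA (mulrA (star w)) (mulrA (star t)) wz tz -mulrDr -mulrDl.
    by rewrite addrC subrK -EC gs mulr0.
  by move/sum_squares_eq0; rewrite -wz -mulrA => ->; rewrite mulr0.
have xg := key u x v (esym xE); have xg' := key v x' u (esym xE').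
have yg : y * E (y * y) = 0.
  rewrite [LHS]mulrBl xg ?xg' ?subrr //; first by rewrite -xE /s addrK.
  by rewrite -xE' /s addrC addKr.
have gg : star (E (y * y)) * E (y * y) = 0.
  by rewrite sg -EM EC yg mulr0 haar_exp0.
apply/eqP; rewrite -subr_eq0; apply/eqP.
exact: (haar_exp_sqr_eq0 haar_h yR sy (star_mul_eq0 gg)).
Qed.

(** Since ε(b l) = ε(b ε_L(l)), normalization depends only on ε_L(l). *)
Lemma normalizedP l : normalized_integral l <-> epsL l = 1.
Proof.
split=> [nl|ll].
  rewrite epsLE -[RHS]counitl; apply: eq_tlift => u v.
  by rewrite -dual_actE nl.
by apply/lfunP => b; rewrite dual_actE -counit_epsL ll mulr1.
Qed.

Lemma AL_haar_id y : in_AL y -> y * h = h -> y = 1.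
Proof.
by move=> yL yh; rewrite -[y]mulr1 -(haar_epsL haar_h) -epsL_ALmul // yh.
Qed.

(** Both sides lie in A_R, where right multiplication by h is injective, and both products with h
    equal l h. *)
Lemma nR_central l : left_integral l -> nR l = E (dR l).
Proof.
move=> lI; have lh : nR l * h = E (dR l) * h.
  rewrite nRE (haarl haar_h) epsL_epsRb -(haarl haar_h) (haar_exp_central haar_h).
  by rewrite -(haar_expE haar_h) -(left_integralE haar_h lI).
apply/eqP; rewrite -subr_eq0; apply/eqP; apply: (haar_AR_injl haar_h).
  by apply: AR_D; [rewrite nRE; exact: epsRb_AR|apply: AR_N; exact: haar_exp_AR].
by rewrite mulrBl lh subrr.
Qed.

Lemma dual_mul_haar (phi psi : 'Hom(A, K^o)) a b : in_AR a -> in_AR b ->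
  dual_mul phi psi (a * h * b) =
  \Sw_(h1, h2 <- comul h) ((phi h1 : K) *: psi (a * h2 * b)) :> K.
Proof.
move=> aR bR; rewrite dual_mulE.
rewrite (comul_mulAR (F := fun u v => (phi u : K) *: psi v) _ bR); [|wlin|wlin].
rewrite (comul_ARmul (F := fun u v => (phi u : K) *: psi (v * b)) _ aR); [|wlin|wlin].
by [].
Qed.

Definition dual_conj p q (psi : 'Hom(A, K^o)) : 'Hom(A, K^o) :=
  linfun (fun t => psi (p * t * q)).

Lemma dual_conjE p q psi t : dual_conj p q psi t = psi (p * t * q).
Proof. by apply: (linfun_lin (f := fun t => psi (p * t * q))); wlin. Qed.

(** The coordinates of t z, as functionals of t, pair to zero with everything because x z = 0. They
    vanish by nondegeneracy; t = 1 gives z = 0. *)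
Lemma nondegenerate_haar_inj a x z : in_AR a -> in_AR x ->
  nondegenerate_functional (a * h * x) -> x * z = 0 -> z = 0.
Proof.
move=> aR xR [_ nd] xz; rewrite (coord_vbasis (memvf z)) big1 // => i _.
pose f t : K^o := coord (vbasis {:A}) i (t * z).
have lf : linear f by move=> c u v; rewrite /f mulrDl -scalerAl linearP.
suff /(congr1 (fun g : 'Hom(A, K^o) => g 1)) : linfun f = 0.
  by rewrite linfun_lin // /f mul1r lfunE /= => ->; rewrite scale0r.
apply: nd => phi; rewrite dual_mul_haar // /tlift big1 // => j _.
by rewrite linfun_lin // /f -[_ * x * z]mulrA xz mulr0 linear0 scaler0.
Qed.

(** An injective left multiplication is surjective in finite dimension, giving a right inverse,
    whose adjoint is a left inverse. *)
Lemma sa_inj_inv x : star x = x -> (forall z, x * z = 0 -> z = 0) ->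
  exists c, x * c = 1 /\ c * x = 1.
Proof.
move=> sx xi; have k0 : lker (amull x) == 0%VS.
  apply/lker0P => u v; rewrite !lfunE /= => uv; apply/eqP; rewrite -subr_eq0.
  by apply/eqP/xi; rewrite mulrBr uv subrr.
pose c := (amull x)^-1%VF 1; have xc : x * c = 1.
  by have := lker0_lfunVK k0 1; rewrite lfunE.
have cx : star c * x = 1 by rewrite -[in LHS]sx -starM xc star1.
by exists c; split=> //; rewrite -[c]mul1r -cx -[star c * x * c]mulrA xc mulr1.
Qed.

(** Outer factors from A_R touch only the second leg of Δ(h), so the two forms differ by the
    invertible substitution [dual_conj p q] in the second argument. *)
Lemma nondegenerate_transfer a b a' b' p p' q q' :
  in_AR a -> in_AR b -> in_AR a' -> in_AR b' ->
  p * p' = 1 -> p' * p = 1 -> q * q' = 1 -> q' * q = 1 -> p * a' = a -> b' * q = b ->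
  nondegenerate_functional (a' * h * b') -> nondegenerate_functional (a * h * b).
Proof.
move=> aR bR aR' bR' pp pp' qq qq' pa qb [n1 n2].
have E phi psi : dual_mul phi psi (a * h * b) =
    dual_mul phi (dual_conj p q psi) (a' * h * b').
  rewrite !dual_mul_haar //; apply: eq_tlift => u v.
  by rewrite dual_conjE -pa -qb !mulrA.
split=> [phi H|psi H].
  apply: n1 => psi; rewrite -[psi](_ : dual_conj p q (dual_conj p' q' psi) = _).
    by rewrite -E.
  apply/lfunP => t; rewrite !dual_conjE !mulrA pp' mul1r.
  by rewrite -[t * q * q']mulrA qq mulr1.
have H0 : dual_conj p q psi = 0 by apply: n2 => phi; rewrite -E.
apply/lfunP => t; rewrite -[t](_ : p * (p' * t * q') * q = _).
  by rewrite -dual_conjE H0 !lfunE.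
by rewrite !mulrA pp mul1r -[t * q' * q]mulrA qq' mulr1.
Qed.

End JonesElement.

(** * Commutation relations in the crossed product *)

Section CrossedProductElements.
Variables (R : realType) (A : weakHopfType R) (M : moduleAlgType A).
Implicit Types (a b r l h : A) (m n : M).

Lemma crossed_AM a b : crossed_A M a * crossed_A M b = crossed_A M (a * b).
Proof.
rewrite /crossed_A rtimesM -rtimes_unit.
by apply: eq_tlift => u v.
Qed.

Lemma crossed_M_A m a : crossed_M m * crossed_A M a = rtimes m a.
Proof. by rewrite rtimesM rtimes_unit mul1r. Qed.

(** The first leg of Δ(r) is that of Δ(1), so r acts on m as the unit does. *)
Lemma crossed_AR_M r m : in_AR r ->
  crossed_A M r * crossed_M m = crossed_M m * crossed_A M r.
Proof.
move=> rR; rewrite crossed_M_A -[RHS]mul1r !rtimesM.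
rewrite (comul_ARl (F := fun u v => rtimes (1 * act u m) (v * 1)) rR).
- by apply: eq_tlift => u v; rewrite mulr1.
- by move=> b; apply: rtimes_linl'; wlin.
by move=> a; apply: rtimes_linr'; wlin.
Qed.

(** The integral turns a_(2) h into ε_L(a_(2)) h, and balancing moves this factor to M, where it
    becomes the action of a_(2) on 1. *)
Lemma crossed_A_left_integral a m h : left_integral h ->
  crossed_A M a * rtimes m h = rtimes (act a m) h.
Proof.
move=> hI; rewrite rtimesM -[m in RHS]mulr1 act_mul.
rewrite [RHS](lin_tlift _ _ (rtimes_linl h)).
apply: eq_tlift => u v; rewrite mul1r hI act_one.
by rewrite rtimes_balanced //; exact: epsL_AL.
Qed.

(** Invariance allows trading [epsL a] for [epsRb a] in A_R, whose coproduct puts it on the second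
    factor of n = n 1 only. *)
Lemma act_invariant_epsL a n : act_invariant n ->
  act (epsL a) n = n * act (epsL a) 1.
Proof.
move=> nI; rewrite -(epsL_epsRb a) -nI -act_one -[n in LHS]mulr1 act_mul.
rewrite (comul_ARl (F := fun u v => act u n * act v 1) (epsRb_AR a)); [|wlin|wlin].
rewrite -[RHS]act1 act_mul; apply: eq_tlift => u v.
by rewrite actM.
Qed.

(** The action of a_(1) on n is right multiplication by that of ε_L(a_(1)) on 1; balancing moves it
    before a_(2), and ε_L(a_(1)) a_(2) = a. *)
Lemma crossed_A_invariant a n : act_invariant n ->
  crossed_A M a * crossed_M n = crossed_M n * crossed_A M a.
Proof.
move=> nI; rewrite crossed_M_A rtimesM -[in RHS](epsL_mul a).
rewrite (lin_tlift _ _ (rtimes_linr n)); apply: eq_tlift => u v.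
rewrite mul1r mulr1 nI act_invariant_epsL // rtimes_balanced //.
exact: epsL_AL.
Qed.

End CrossedProductElements.

Theorem proposition3p3p1 (R : realType) (A : weakHopfType R)
    (M : moduleAlgType A) (h l : A) (haar_h : haar_integral h)
    (l_left : left_integral l) (l_pos : positive_functional l) :
  let e := jones_element h l in
  let E := @cond_exp R A M l in
  [/\ (* (i) *)
      [/\ cpos e,
          forall n : M, act_invariant n ->
            crossed_A M e * crossed_M n = crossed_M n * crossed_A M e &
          forall m : M,
            crossed_A M e * crossed_M m * crossed_A M e
              = crossed_M (E m) * crossed_A M e /\
            crossed_M (E m) * crossed_A M e
              = crossed_A M e * crossed_M (E m)],
      (* (ii) *)
      forall l' : A, left_integral l' -> positive_functional l' ->
        e = jones_element h l' -> l = l',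
      (* (iii) *)
      [/\ e * e = nL l * e,
          e * e = nR l * e &
          normalized_integral l -> is_projection e] &
      (* (iv) *)
      (nondegenerate_functional l <-> nondegenerate_functional e) /\
      (nondegenerate_functional l -> (normalized_integral l <-> is_projection e))].
Proof.
move=> e E.
have sqrtd (k : A) : positive_functional k -> let x := csqrt (dR k) in
    [/\ in_AR x, cpos x & x * x = dR k].
  move=> /dR_pos_on_min/csqrtP[[f fE] xp xx]; split=> //.
  by rewrite fE; apply: AR_pev; exact: epsR_AR.
have lE (k : A) : left_integral k -> k = h * dR k := @left_integralE R A h haar_h k.
have [hs hh] := (haar_star haar_h, haar_idem haar_h).
rewrite {}/e /jones_element; have [] := sqrtd l l_pos.
set x := csqrt (dR l) => xR xp xx; have sx := cpos_star xp.
have Einv m : act_invariant (E m) := cond_exp_invariant m l_left.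
have lh : l * h = epsL l * h := haarl haar_h l.
(* The inner h x x is l, by l = h d_R(l). *)
have ee : x * h * x * (x * h * x) = x * (l * h) * x.
  by rewrite [X in x * (X * h)]lE // -xx !mulrA.
have se : star (x * h * x) = x * h * x by rewrite !starM hs sx mulrA.
have eL : x * h * x * (x * h * x) = nL l * (x * h * x).
  by rewrite ee lh -/(epsL l) !mulrA (AL_AR_comm (epsL_AL l) xR).
have proj_e : normalized_integral l -> is_projection (x * h * x).
  by move/normalizedP => ll; split=> //; rewrite eL /nL -/(epsL l) ll mul1r.
split.
- split.
  + by exists (h * x); rewrite starM hs sx mulrA -[in RHS](mulrA x) hh.
  + by move=> n nI; apply: crossed_A_invariant.
  move=> m; split; last by rewrite crossed_A_invariant.
  rewrite -!crossed_AM; set X := crossed_A M x; set H := crossed_A M h.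
  have XM n : X * crossed_M n = crossed_M n * X by apply: crossed_AR_M.
  have HXXH : H * X * X = crossed_A M l by rewrite !crossed_AM -mulrA xx -lE.
  have LMH : crossed_A M l * (crossed_M m * H) = crossed_M (E m) * H.
    by rewrite !crossed_M_A crossed_A_left_integral //; case: haar_h.
  rewrite !mulrA -(mulrA _ (crossed_M m) X) -XM.
  transitivity (X * (H * X * X * (crossed_M m * H)) * X); first by rewrite !mulrA.
  by rewrite HXXH LMH !mulrA XM.
- move=> l' l_left' l_pos'; have [] := sqrtd l' l_pos'.
  set x' := csqrt (dR l') => xR' xp' xx' exx.
  have xE := jones_inj haar_h xR xR' xp xp' exx.
  by rewrite (lE l) // (lE l') // -xx -xx' xE.
(* For n_R: l h = h d_R(l) h = E(d_R(l)) h, and the central factor moves out past x. *)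
- split=> //; rewrite ee lh -/(nL l) (nR_central haar_h) //.
  have -> : nL l * h = haar_exp h (dR l) * h.
    rewrite -lh [X in X * _ = _](lE l l_left) (haar_expE haar_h).
    by rewrite (haar_exp_central haar_h).
  by rewrite !mulrA -(haar_exp_central haar_h).
(* This form a h b with a, b in A_R makes l comparable with e = x h x. *)
have lxx : l = 1 * h * (x * x) by rewrite mul1r xx -lE.
have inv : nondegenerate_functional l \/ nondegenerate_functional (x * h * x) ->
    exists c, x * c = 1 /\ c * x = 1.
  move=> nd; apply: sa_inj_inv => // z xz.
  case: nd => [|nd]; last exact: (nondegenerate_haar_inj xR xR nd xz).
  rewrite lxx => nd; apply: (nondegenerate_haar_inj (in_AR1 A) (AR_mul xR xR) nd).
  by rewrite -mulrA xz mulr0.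
have [R1 Rxx] : in_AR (1 : A) /\ in_AR (x * x) by split; [exact: in_AR1|exact: AR_mul].
split.
  split=> nd.
    have [c [xc cx]] := inv (or_introl nd); rewrite lxx in nd.
    (* The substitution has p = x and q = c, the inverse of x: x 1 = x on the left, x x c = x on the
       right. *)
    apply: (nondegenerate_transfer xR xR R1 Rxx xc cx cx xc _ _ nd).
      by rewrite mulr1.
    by rewrite -mulrA xc mulr1.
  have [c [xc cx]] := inv (or_intror nd); rewrite lxx.
  exact: (nondegenerate_transfer R1 Rxx xR xR cx xc xc cx cx (erefl _) nd).
move=> nd; have [c [xc cx]] := inv (or_introl nd).
split=> // -[_ pe]; apply/normalizedP/(AL_haar_id haar_h (epsL_AL l)).
(* As n_L(l) commutes with x, cancelling x on both sides of n_L(l) e = e leaves n_L(l) h = h. *)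
have := congr1 (fun z => c * z * c) (etrans (esym eL) pe).
rewrite !mulrA -(mulrA c) (AL_AR_comm (epsL_AL l) xR) !mulrA cx mul1r.
by rewrite -mulrA xc mulr1 mul1r -mulrA xc mulr1.
Qed.
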